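(* Let $C>0$ be any fixed constant and let $p=p(n)\in[0,1]$ be a sequence of probability values. For $\Gamma\in G(n,p)$ the following hold asymptotically almost surely: (1) If $pn^2\to 0$, then $\Gamma$ has no adjacent domination pairs. (2) If $p<\frac{\log(n)+\log(\log(n))-\omega(n)}{n}$ for some sequence $\omega(n)\to+\infty$, then $\Gamma$ has at least $C$ non-adjacent domination pairs. (3) If $p<\frac{\log(n)+\log(\log(n))-\omega(n)}{n}$ for some sequence $\omega(n)\to+\infty$ and in addition $pn^2\to\infty$, then $\Gamma$ also has at least $C$ adjacent domination pairs. (4) If $\frac{\log(n)+\log(\log(n))+\omega_1(n)}{n}<p<1-\frac{\log(n)+\log(\log(n))+\omega_2(n)}{n}$ for some sequences $\omega_1(n),\omega_2(n)\to+\infty$, then $\Gamma$ has no domination pairs. (5) If $p>1-\frac{\log(n)+\log(\log(n))-\omega(n)}{n}$ for some sequence $\omega(n)\to+\infty$, then $\Gamma$ has at least $C$ adjacent domination pairs. (6) If $p>1-\frac{\log(n)+\log(\log(n))-\omega(n)}{n}$ for some sequence $\omega(n)\to+\infty$ and in addition $(1-p)n^2\to\infty$, then $\Gamma$ also has at least $C$ non-adjacent domination pairs. (7) If $(1-p)n^2\to 0$, then $\Gamma$ has no non-adjacent domination pairs.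
   Context: All graphs are finite simplicial graphs. $G(n,p)$ is the Erdős–Rényi model: the probability space of all simplicial graphs on a fixed vertex set $V$ with $|V|=n$, where each of the $\binom n2$ possible edges is present independently with probability $p=p(n)$. A property holds asymptotically almost surely (a.a.s.) if its probability tends to $1$ as $n\to\infty$. $\log$ is the natural logarithm. For a vertex $a$, $\mathrm{st}(a)$ is the set consisting of $a$ and all vertices adjacent to $a$. For distinct vertices $a,b$, $a$ dominates $b$ (written $a>b$; $(a,b)$ is a domination pair) if every vertex adjacent to $b$ is adjacent to or equal to $a$, i.e. $\mathrm{st}(b)\setminus\{b\}\subset\mathrm{st}(a)$. A domination pair $(a,b)$ is adjacent if $a$ is adjacent to $b$, and non-adjacent otherwise. *)

(* Defs.v *)
From HB Require Import structures.
From mathcomp Require Import all_boot all_order all_algebra.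
From mathcomp Require Import all_classical all_reals all_analysis.
Set Implicit Arguments. Unset Strict Implicit. Unset Printing Implicit Defensive.
Import Order.TTheory GRing.Theory Num.Theory numFieldNormedType.Exports.
Local Open Scope classical_set_scope.
Local Open Scope ring_scope.

Definition edge (n : nat) := {e : 'I_n * 'I_n | (e.1 < e.2)%N}.

Definition graph (n : nat) := {set edge n}.

Definition adj (n : nat) (g : graph n) (a b : 'I_n) : bool :=
  [exists e in g, (val e == (a, b)) || (val e == (b, a))].

Definition dominates (n : nat) (g : graph n) (a b : 'I_n) : bool :=
  (a != b) && [forall v, adj g b v ==> ((v == a) || adj g a v)].

Definition n_adj_dom (n : nat) (g : graph n) : nat :=
  #|[set ab : 'I_n * 'I_n | dominates g ab.1 ab.2 && adj g ab.1 ab.2]|.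
Definition n_nonadj_dom (n : nat) (g : graph n) : nat :=
  #|[set ab : 'I_n * 'I_n | dominates g ab.1 ab.2 && ~~ adj g ab.1 ab.2]|.

Definition gnp_weight (R : realType) (n : nat) (p : R) (g : graph n) : R :=
  p ^+ #|g| * (1 - p) ^+ (#|[set: edge n]| - #|g|).

Definition gnp_prob (R : realType) (n : nat) (p : R) (P : pred (graph n)) : R :=
  \sum_(g : graph n | P g) gnp_weight p g.

Definition aas (R : realType) (p : nat -> R) (P : forall n, pred (graph n)) : Prop :=
  (gnp_prob (p n) (P n)) @[n --> \oo] --> (1 : R).

Definition thr (R : realType) (n : nat) : R := ln (n%:R) + ln (ln (n%:R)).

(* Main.v *)
(** Complementation exchanges [p] with [1 - p] and adjacent with non-adjacent
    domination pairs, so (5)-(7) follow from (2), (3), (1), and (4) reduces to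
    [p <= 1/2].  Write [x = n p].

    (1) is a union bound over the edges.  A leaf [b] with neighbour [c] gives the
    adjacent pair [(c, b)]; the expected number of leaves is of order [n x e^-x],
    which tends to infinity below the threshold as soon as [n^2 p] does, and the
    second moment method gives (3).  For (2), if [x <= (3/4) log n] there is an
    isolated vertex, which is dominated by every other vertex; otherwise there are
    many leaves and no isolated edge, so that the neighbour of each leaf has
    another neighbour, which dominates the leaf.

    For (4), above the threshold there are no vertices of degree at most 1.  If [b]
    has larger degree and is dominated by [a], then either [a], [b] and a third
    vertex form a triangle in which [b] has degree 2, or [a] and [b] have two common
    neighbours and every other neighbour of [b] is one of [a]; the expected numbers
    of such configurations are at most about [x^3 e^-x] and [x^4 e^(-x/2)]. *)

Require Import Defs.
From HB Require Import structures.
From mathcomp Require Import all_boot all_order all_algebra.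
From mathcomp Require Import all_classical all_reals all_analysis.
(* Imported again so that finite-set names shadow those of classical_sets. *)
From mathcomp Require Import fintype finset.
From mathcomp Require Import ring lra zify.
Set Implicit Arguments. Unset Strict Implicit. Unset Printing Implicit Defensive.
Import Order.TTheory GRing.Theory Num.Theory numFieldNormedType.Exports.
Local Open Scope ring_scope.

(** * The probability space G(n,p) *)

Section GnpProb.
Context {R : realType} {n : nat}.
Implicit Types (p : R) (g : graph n) (P Q : pred (graph n)) (S T : {set edge n}).

Lemma gnp_weightE p g :
  gnp_weight p g = \prod_e (if e \in g then p else 1 - p).
Proof.
rewrite (bigID (mem g)) /= (eq_bigr (fun=> p)); last by move=> e ->.
rewrite [X in _ = _ * X](eq_bigr (fun=> 1 - p)); last by move=> e /negbTE ->.
rewrite !prodr_const /gnp_weight; congr (_ * _ ^+ _).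
have -> : #|[set: edge n]%classic| = #|{: edge n}|.
  by apply: eq_card => e; rewrite classical_sets.in_setT.
by rewrite -(cardC (mem g)) addKn; apply: eq_card.
Qed.

Lemma gnp_weight_ge0 p g : 0 <= p <= 1 -> 0 <= gnp_weight p g.
Proof. by case/andP=> p0 p1; rewrite mulr_ge0 ?exprn_ge0 ?subr_ge0. Qed.

Lemma gnp_weightC p g : gnp_weight (1 - p) (~: g) = gnp_weight p g.
Proof.
rewrite !gnp_weightE; apply: eq_bigr => e _; rewrite inE.
by case: (e \in g) => //=; rewrite opprB addrC subrK.
Qed.

Lemma gnp_probC p P : gnp_prob (1 - p) P = gnp_prob p (fun g => P (~: g)).
Proof.
rewrite /gnp_prob (reindex_inj (@setC_inj _)) /=.
by apply: eq_bigr => g _; rewrite gnp_weightC.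
Qed.

Lemma gnp_prob_ge0 p P : 0 <= p <= 1 -> 0 <= gnp_prob p P.
Proof. by move=> hp; apply: sumr_ge0 => g _; apply: gnp_weight_ge0. Qed.

(** The cylinder event that the edges of [S] are present and those of [T] absent. The configurations
    below are built from such events, so their probabilities reduce to counting edges. *)
Definition cyl S T : pred (graph n) := fun g => (S \subset g) && (T \subset ~: g).

Lemma cylI S T S' T' g :
  cyl S T g && cyl S' T' g = cyl (S :|: S') (T :|: T') g.
Proof. by rewrite /cyl !subUset andbACA. Qed.

(** Weight times indicator is a product over edges, with factor [F e] for a present and [G e] for an
    absent edge. By distributivity the sum over all graphs is the product of [F e + G e], which is
    [p] on [S], [1 - p] on [T] and 1 elsewhere. *)
Lemma prob_cyl p S T : [disjoint S & T] ->
  gnp_prob p (cyl S T) = p ^+ #|S| * (1 - p) ^+ #|T|.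
Proof.
move=> dST.
pose F e := if e \in T then 0 else p.
pose G e := if e \in S then 0 else 1 - p.
have -> : gnp_prob p (cyl S T) = \sum_(g : graph n) \prod_e (if e \in g then F e else G e).
  rewrite /gnp_prob big_mkcond /=; apply: eq_bigr => g _.
  case: ifP => [/andP[Sg Tg]|].
    rewrite gnp_weightE; apply: eq_bigr => e _; rewrite /F /G.
    case: ifPn => eg; first by case: ifP => // /(subsetP Tg); rewrite inE eg.
    by case: ifP => // /(subsetP Sg); rewrite (negbTE eg).
  move/negbT; rewrite negb_and => /orP[] /subsetPn[e eS eg]; rewrite (bigD1 e) //=.
    by rewrite (negbTE eg) /G eS mul0r.
  by move: eg; rewrite inE negbK => ->; rewrite /F eS mul0r.
rewrite -bigA_distr.
rewrite (bigID (mem S)) /= (eq_bigr (fun=> p)); last first.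
  by move=> e eS; rewrite /F /G eS (disjointFr dST) // addr0.
rewrite prodr_const; congr (_ * _).
rewrite (bigID (mem T)) /= [X in _ * X]big1 => [|e /andP[eS eT]]; last first.
  by rewrite /F /G (negbTE eS) (negbTE eT) addrC subrK.
rewrite mulr1 (eq_bigr (fun=> 1 - p)); last first.
  by move=> e /andP[eS eT]; rewrite /F /G (negbTE eS) eT add0r.
rewrite prodr_const; congr (_ ^+ _); apply: eq_card => e; rewrite unfold_in /=.
by case eT: (e \in T); rewrite ?andbF // (disjointFl dST).
Qed.

(** If [S] and [T] meet, the event is empty; so upper bounds require no check of disjointness. *)
Lemma prob_cyl_le p S T : 0 <= p <= 1 ->
  gnp_prob p (cyl S T) <= p ^+ #|S| * (1 - p) ^+ #|T|.
Proof.
move=> /andP[p0 p1]; have [dST|nd] := boolP [disjoint S & T]; first by rewrite prob_cyl.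
rewrite /gnp_prob big_pred0 ?mulr_ge0 ?exprn_ge0 ?subr_ge0 // => g.
apply: contraNF nd => /andP[Sg Tg]; rewrite disjoints_subset.
by apply: subset_trans Sg _; rewrite -setCS setCK.
Qed.

Lemma gnp_prob_predT p : @gnp_prob R n p xpredT = 1.
Proof.
have := @prob_cyl p set0 set0; rewrite disjoints_subset sub0set cards0 expr0 mulr1.
by move=> <- //; apply: eq_bigl => g; rewrite /cyl !sub0set.
Qed.

Lemma gnp_prob_not p P : gnp_prob p P = 1 - gnp_prob p (fun g => ~~ P g).
Proof. by rewrite -(gnp_prob_predT p) /gnp_prob [X in _ = X - _](bigID P) /= addrK. Qed.

Lemma gnp_prob_le p P Q : 0 <= p <= 1 -> (forall g, P g -> Q g) ->
  gnp_prob p P <= gnp_prob p Q.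
Proof.
move=> hp PQ; rewrite /gnp_prob big_mkcond [leRHS]big_mkcond /=.
apply: ler_sum => g _; case: ifP => [/PQ ->//|_].
by case: ifP => // _; apply: gnp_weight_ge0.
Qed.

Lemma gnp_prob_union p (I : finType) (A : pred I) P (Q : I -> pred (graph n)) :
  0 <= p <= 1 -> (forall g, P g -> exists2 i, A i & Q i g) ->
  gnp_prob p P <= \sum_(i | A i) gnp_prob p (Q i).
Proof.
move=> hp PQ; rewrite /gnp_prob.
under [leRHS]eq_bigr do rewrite big_mkcond.
rewrite exchange_big /= big_mkcond; apply: ler_sum => g _.
have h0 i : A i -> 0 <= (if Q i g then gnp_weight p g else 0).
  by case: ifP => // _ _; apply: gnp_weight_ge0.
case: ifP => [/PQ[i Ai Qi]|_]; last exact: sumr_ge0.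
by rewrite (bigD1 i) //= Qi lerDl sumr_ge0 // => j /andP[/h0].
Qed.

Lemma gnp_prob_union_const p (I : finType) (A : pred I) P (Q : I -> pred (graph n)) c :
  0 <= p <= 1 -> (forall g, P g -> exists2 i, A i & Q i g) ->
  (forall i, A i -> gnp_prob p (Q i) <= c) ->
  gnp_prob p P <= #|A|%:R * c.
Proof.
move=> hp PQ Qc; apply: le_trans (gnp_prob_union hp PQ) _.
by apply: le_trans (ler_sum _ Qc) _; rewrite sumr_const mulr_natl.
Qed.

Lemma gnp_prob_or p P Q : 0 <= p <= 1 ->
  gnp_prob p (fun g => P g || Q g) <= gnp_prob p P + gnp_prob p Q.
Proof.
move=> hp; have := @gnp_prob_union p bool xpredT (fun g => P g || Q g)
  (fun b => if b then P else Q) hp.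
rewrite big_bool; apply => g /orP[] h; by [exists true | exists false].
Qed.

(** The second moment method. Let [X] count the events that occur. The hypothesis on pairs bounds
    the variance of [X] by [mu ^+ 2 * d], and [X < C <= mu / 2] forces a deviation of at least
    [mu / 2], so Chebyshev's inequality gives [4 * d]. *)
Lemma chebyshev_count p (I : finType) (A : I -> pred (graph n)) (mu d C : R) :
  0 <= p <= 1 ->
  mu = \sum_i gnp_prob p (A i) ->
  \sum_i \sum_j gnp_prob p (fun g => A i g && A j g) <= mu ^+ 2 * (1 + d) ->
  0 < mu -> 2 * C <= mu ->
  gnp_prob p (fun g => (\sum_i (A i g : nat))%:R < C) <= 4 * d.
Proof.
move=> hp muE h2 mu0 hC.
pose X g : R := (\sum_i (A i g : nat))%:R.
have w0 g := @gnp_weight_ge0 p g hp.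
have EX : \sum_(g : graph n) gnp_weight p g * X g = mu.
  rewrite muE /gnp_prob.
  under [RHS]eq_bigr do rewrite big_mkcond.
  rewrite exchange_big /=; apply: eq_bigr => g _.
  rewrite /X natr_sum mulr_sumr; apply: eq_bigr => i _.
  by case: (A i g); rewrite ?mulr1 ?mulr0.
have EX2 : \sum_(g : graph n) gnp_weight p g * X g ^+ 2 <= mu ^+ 2 * (1 + d).
  apply: le_trans h2; rewrite le_eqVlt; apply/orP; left; apply/eqP.
  under [RHS]eq_bigr => i _ do under eq_bigr do rewrite /gnp_prob big_mkcond.
  under [RHS]eq_bigr => i _ do rewrite exchange_big.
  rewrite exchange_big /=; apply: eq_bigr => g _.
  rewrite expr2 /X natr_sum mulr_suml mulr_sumr; apply: eq_bigr => i _.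
  rewrite mulr_sumr mulr_sumr; apply: eq_bigr => j _.
  by case: (A i g); case: (A j g); rewrite ?mulr1 ?mulr0.
have E1 : \sum_(g : graph n) gnp_weight p g = 1 by rewrite -(gnp_prob_predT p).
have var : \sum_(g : graph n) gnp_weight p g * (X g - mu) ^+ 2 <= mu ^+ 2 * d.
  have -> : \sum_(g : graph n) gnp_weight p g * (X g - mu) ^+ 2 =
    \sum_(g : graph n) gnp_weight p g * X g ^+ 2 - 2 * mu * \sum_(g : graph n) gnp_weight p g * X g
      + mu ^+ 2 * \sum_(g : graph n) gnp_weight p g.
    rewrite !mulr_sumr -sumrB -big_split /=; apply: eq_bigr => g _; ring.
  rewrite EX E1; lra.
have : (mu / 2) ^+ 2 * gnp_prob p (fun g => X g < C) <= mu ^+ 2 * d.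
  apply: le_trans var; rewrite /gnp_prob mulr_sumr big_mkcond /=.
  apply: ler_sum => g _; case: ifP => [XC|_]; last by rewrite mulr_ge0 ?sqr_ge0.
  rewrite mulrC ler_wpM2l // -[leRHS]sqrrN lerXn2r ?nnegrE //; lra.
have -> : mu ^+ 2 * d = (mu / 2) ^+ 2 * (4 * d) by field.
by rewrite ler_pM2l // exprn_gt0 // divr_gt0.
Qed.

End GnpProb.

(** * Domination, leaves and isolated vertices *)

Section Domination.
Context {n : nat}.
Implicit Types (g : graph n) (a b c v : 'I_n).

Lemma adjC g a b : adj g a b = adj g b a.
Proof. by rewrite /adj; apply: eq_existsb => e; rewrite orbC. Qed.

Lemma adj_irr g a : adj g a a = false.
Proof.
apply/negbTE/existsP => -[[[x y] /= xy]] /andP[_].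
by rewrite orbb => /eqP[]; move: xy => /[swap] -> /[swap] ->; rewrite ltnn.
Qed.

Lemma adj_setC g a b : adj (~: g) a b = (a != b) && ~~ adj g a b.
Proof.
have [->|ab] := eqVneq a b; first by rewrite adj_irr.
wlog lt : a b ab / (a < b)%N.
  by move=> H; case: (ltngtP a b) => [/H->//|/H|/val_inj/eqP];
     [rewrite adjC [adj g a b]adjC; apply; rewrite eq_sym | rewrite (negbTE ab)].
have key (h : graph n) : adj h a b = (exist _ (a, b) lt \in h).
  apply/existsP/idP => [[[[x y] /= xy] /andP[eh]]|eh]; last first.
    by exists (exist _ (a, b) lt); rewrite eh eqxx.
  case/orP=> /eqP[? ?]; subst; first by rewrite (bool_irrelevance lt xy).
  by have := ltn_trans xy lt; rewrite /= ltnn.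
by rewrite !key inE.
Qed.

(** The counts are defined through classical sets; a boolean predicate gives access to the
    finite-type lemmas. *)
Lemma n_adj_domE g :
  n_adj_dom g = #|[pred ab : 'I_n * 'I_n | dominates g ab.1 ab.2 && adj g ab.1 ab.2]|.
Proof. by apply: eq_card => ab; apply/idP/idP => [/set_mem|h] //; apply: mem_set. Qed.

Lemma n_nonadj_domE g :
  n_nonadj_dom g =
  #|[pred ab : 'I_n * 'I_n | dominates g ab.1 ab.2 && ~~ adj g ab.1 ab.2]|.
Proof. by apply: eq_card => ab; apply/idP/idP => [/set_mem|h] //; apply: mem_set. Qed.

Lemma dominatesP g a b :
  reflect (a != b /\ forall v, adj g b v -> v != a -> adj g a v) (dominates g a b).
Proof.
apply: (iffP andP) => -[ab H]; split => //.
  by move=> v bv va; have := forallP H v; rewrite bv (negbTE va).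
by apply/forallP => v; apply/implyP => bv; have [//|va] := eqVneq v a; apply: H.
Qed.

(** Contraposition: the neighbours of [b] lie among those of [a] exactly when the non-neighbours of
    [a] lie among those of [b]. The roles of [a] and [b] are therefore exchanged. *)
Lemma dominates_setC g a b : dominates (~: g) a b = dominates g b a.
Proof.
apply/dominatesP/dominatesP; rewrite eq_sym => -[ab H]; split => // v.
  move=> av vb; apply: contraT => nbv; have := H v; rewrite !adj_setC.
  rewrite (eq_sym b) vb nbv av andbF => /(_ isT); apply.
  by apply: contraTneq av => ->; rewrite adj_irr.
rewrite !adj_setC => /andP[bv nbv] va; rewrite eq_sym va /=.
by apply: contra nbv => av; apply: H; rewrite // eq_sym.
Qed.

Lemma n_adj_dom_setC g : n_adj_dom (~: g) = n_nonadj_dom g.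
Proof.
rewrite n_adj_domE n_nonadj_domE.
pose sw (ab : 'I_n * 'I_n) := (ab.2, ab.1).
have swI : injective sw by move=> [a b] [c d] [-> ->].
rewrite -!sum1_card (reindex_inj swI) /=; apply: eq_bigl => -[a b].
rewrite !inE /= dominates_setC adj_setC (adjC g b).
by apply/andP/andP => -[dab] => [/andP[]|nab]; rewrite ?dab // nab; case/dominatesP: dab; rewrite eq_sym => ->.
Qed.

Lemma n_nonadj_dom_setC g : n_nonadj_dom (~: g) = n_adj_dom g.
Proof. by rewrite -n_adj_dom_setC setCK. Qed.

End Domination.

(** * Edges given by their endpoints, and stars; [n] is [m.+2] so that a default edge exists *)

Section Edges.
Context {m : nat}.
Local Notation n := m.+2.
Implicit Types (g : graph n) (a b c v : 'I_n) (J : {set 'I_n}).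

(* [edge_of a a] is a junk edge. *)
Definition edge_of a b : edge n :=
  insubd (exist _ (ord0, ord_max) isT : edge n) (if (a < b)%N then (a, b) else (b, a)).

Lemma edge_ofC a b : edge_of a b = edge_of b a.
Proof.
by rewrite /edge_of; case: ltngtP => // /val_inj ->.
Qed.

Lemma val_edge_of a b : a != b ->
  val (edge_of a b) = if (a < b)%N then (a, b) else (b, a).
Proof.
rewrite /edge_of val_insubd => ab; case: (ltngtP a b) => /= [->//|->//|/val_inj/eqP].
by rewrite (negbTE ab).
Qed.

Lemma edge_of_inj a b c v : a != b -> c != v -> edge_of a b = edge_of c v ->
  (a == c) && (b == v) || (a == v) && (b == c).
Proof.
move=> ab cv /(congr1 val); rewrite !val_edge_of //.
by case: ifP => _; case: ifP => _ [-> ->]; rewrite !eqxx ?orbT.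
Qed.

Lemma adjE g a b : a != b -> adj g a b = (edge_of a b \in g).
Proof.
move=> ab; apply/existsP/idP => [[e /andP[eg ee]]|abg]; last first.
  exists (edge_of a b); rewrite abg val_edge_of //.
  by case: ifP => _; rewrite eqxx ?orbT.
suff <- : e = edge_of a b by [].
apply: val_inj; rewrite val_edge_of //; case: e {eg} ee => -[x y] /= xy.
by case/orP=> /eqP[? ?]; subst; [rewrite xy | rewrite ltnNge ltnW ?xy].
Qed.

Definition star b J : {set edge n} := [set edge_of b v | v in J].

Lemma card_star b J : b \notin J -> #|star b J| = #|J|.
Proof.
move=> bJ; rewrite card_in_imset // => v w vJ wJ.
have bn x : x \in J -> b != x by apply: contraTneq => <-.
move/edge_of_inj => /(_ (bn _ vJ) (bn _ wJ)) /orP[/andP[_ /eqP//]|/andP[bw]].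
by move: bJ; rewrite (eqP bw) wJ.
Qed.

Lemma star_subP b J g : b \notin J ->
  reflect (forall v, v \in J -> adj g b v) (star b J \subset g).
Proof.
move=> bJ; have bn x : x \in J -> b != x by apply: contraTneq => <-.
apply: (iffP subsetP) => [H v vJ|H _ /imsetP[v vJ ->]].
  by rewrite adjE ?bn //; apply: H; apply: imset_f.
by rewrite -adjE ?H ?bn.
Qed.

Lemma star_subCP b J g : b \notin J ->
  reflect (forall v, v \in J -> ~~ adj g b v) (star b J \subset ~: g).
Proof.
move=> bJ; apply: (iffP (star_subP _ bJ)) => H v vJ.
  by have := H v vJ; rewrite adj_setC => /andP[].
by rewrite adj_setC H // andbT; apply: contraNneq bJ => ->.
Qed.

End Edges.

Section Stars.
Context {m : nat}.
Local Notation n := m.+2.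
Implicit Types (g : graph n) (a b c v : 'I_n) (J K : {set 'I_n}).

(** An edge with distinct centres [b] and [c] among its endpoints can only join them; hence two
    stars overlap in at most one edge. *)
Lemma star_meet b c J K e : b != c -> b \notin J -> c \notin K ->
  e \in star b J -> e \in star c K -> c \in J /\ e = edge_of b c.
Proof.
move=> bc bJ cK /imsetP[v vJ ->] /imsetP[w wK].
have bv : b != v by apply: contraNneq bJ => ->.
have cw : c != w by apply: contraNneq cK => ->.
case/(edge_of_inj bv cw)/orP => /andP[].
  by rewrite (negbTE bc).
by move=> _ /eqP <-; split.
Qed.

Lemma star_disjoint b c J K : b != c -> b \notin J -> c \notin K -> c \notin J ->
  [disjoint star b J & star c K].
Proof.
move=> bc bJ cK cJ; rewrite -setI_eq0; apply/eqP/setP => e; rewrite !inE.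
by apply/negP => /andP[eb /(star_meet bc bJ cK eb)[]]; rewrite (negbTE cJ).
Qed.

Lemma card_starU b c J K : b != c -> b \notin J -> c \notin K -> c \notin J ->
  #|star b J :|: star c K| = (#|J| + #|K|)%N.
Proof.
move=> bc bJ cK cJ; have := star_disjoint bc bJ cK cJ.
by rewrite -setI_eq0 => /eqP d; rewrite cardsU d cards0 subn0 !card_star.
Qed.

Lemma card_starU_ge b c J K : b != c -> b \notin J -> c \notin K ->
  (#|J| + #|K| - 1 <= #|star b J :|: star c K|)%N.
Proof.
move=> bc bJ cK; rewrite cardsU !card_star //; apply: leq_sub2l.
rewrite -(cards1 (edge_of b c)); apply: subset_leq_card; apply/subsetP => e.
by rewrite !inE => /andP[eb /(star_meet bc bJ cK eb)[_ ->]].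
Qed.

Lemma cardC1_ord b : #|~: [set b]| = m.+1.
Proof. by rewrite cardsCs setCK cards1 card_ord. Qed.

Lemma cardC2_ord b c : b != c -> #|~: [set b; c]| = m.
Proof. by move=> bc; rewrite cardsCs setCK cards2 bc card_ord subn2. Qed.

Lemma cardC3_ord a b c : a != b -> a != c -> b != c -> #|~: [set a; b; c]| = m.-1.
Proof.
move=> ab ac bc; rewrite cardsCs setCK setUC cardsU1 cards2 ab !inE card_ord.
by rewrite (eq_sym c) (negbTE ac) (eq_sym c) (negbTE bc) /= !subSS subn1.
Qed.

Definition isolated_at b : pred (graph n) := cyl set0 (star b (~: [set b])).

Lemma isolated_atP g b : reflect (forall v, ~~ adj g b v) (isolated_at b g).
Proof.
rewrite /isolated_at /cyl sub0set /=.
apply: (iffP (star_subCP g _)) => [|H v|H v _]; rewrite ?inE ?eqxx //.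
by have [->|vb] := eqVneq v b; [rewrite adj_irr | apply: H; rewrite !inE].
Qed.

(** [bc.1] is the leaf and [bc.2] its neighbour. They are required to differ because [edge_of b b]
    is a junk edge that may well be present. *)
Definition leaf_at (bc : 'I_n * 'I_n) : pred (graph n) := fun g =>
  (bc.1 != bc.2) && cyl [set edge_of bc.1 bc.2] (star bc.1 (~: [set bc.1; bc.2])) g.

Lemma leaf_atP g b c : reflect (forall v, adj g b v = (v == c)) (leaf_at (b, c) g).
Proof.
have nb : b \notin ~: [set b; c] by rewrite !inE eqxx.
rewrite /leaf_at /cyl /=; apply: (iffP and3P) => [[bc + /(star_subCP _ nb) H] v|H].
  rewrite sub1set -adjE // => bcg.
  have [->//|vc] := eqVneq v c.
  have [->|vb] := eqVneq v b; first by rewrite adj_irr.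
  by apply/negbTE/H; rewrite !inE negb_or vb vc.
have bc : b != c by apply/eqP => bc; have := H c; rewrite eqxx -bc adj_irr.
split=> //; first by rewrite sub1set -adjE // H.
by apply/(star_subCP _ nb) => v; rewrite !inE H negb_or => /andP[].
Qed.

Lemma leaf_at_nbr g b c v : leaf_at (b, c) g -> adj g b v -> v = c.
Proof. by move=> /leaf_atP -> /eqP. Qed.

Lemma leaf_at_adj g b c : leaf_at (b, c) g -> adj g b c.
Proof. by move=> /leaf_atP ->. Qed.

Lemma leaf_at_neq g b c : leaf_at (b, c) g -> b != c.
Proof. by case/andP. Qed.

Lemma leaf_dominates g b c : leaf_at (b, c) g -> dominates g c b && adj g c b.
Proof.
move=> L; rewrite adjC (leaf_at_adj L) andbT; apply/dominatesP; split.
  by rewrite eq_sym (leaf_at_neq L).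
by move=> v /(leaf_at_nbr L) ->; rewrite eqxx.
Qed.

Lemma leaf_count_le_adj_dom g : (\sum_bc (leaf_at bc g : nat) <= n_adj_dom g)%N.
Proof.
rewrite n_adj_domE -sum1_card big_mkcond [leqRHS]big_mkcond /=.
pose sw (ab : 'I_n * 'I_n) := (ab.2, ab.1).
have swI : injective sw by move=> [a b] [c d] [-> ->].
rewrite [leqRHS](reindex_inj swI) /=; apply: leq_sum => -[b c] _ /=.
by have [L|//] := boolP (leaf_at _ _); rewrite inE /= leaf_dominates.
Qed.

Definition isolated_edge_at (bc : 'I_n * 'I_n) : pred (graph n) :=
  fun g => leaf_at bc g && leaf_at (bc.2, bc.1) g.

(** The neighbour [c] of a leaf [b] has a second neighbour [a], since otherwise [bc] would be an
    isolated edge. Then [a] dominates [b] without being adjacent to it, and the map from [(b, c)] to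
    [(a, b)] is injective because a leaf determines its neighbour. *)
Lemma leaf_count_le_nonadj_dom g : (forall bc, ~~ isolated_edge_at bc g) ->
  (\sum_bc (leaf_at bc g : nat) <= n_nonadj_dom g)%N.
Proof.
move=> noI; rewrite n_nonadj_domE.
have -> : \sum_bc (leaf_at bc g : nat) = #|[pred bc | leaf_at bc g]|.
  by rewrite -sum1_card big_mkcond [RHS]big_mkcond /=; apply: eq_bigr => bc _; rewrite inE; case: ifP.
(* The default [bc.1] is never taken at a leaf, by [noI]. *)
pose other (bc : 'I_n * 'I_n) :=
  (odflt bc.1 [pick a | (a != bc.1) && adj g bc.2 a], bc.1).
have otherP b c : leaf_at (b, c) g -> exists a, [/\ other (b, c) = (a, b), a != b & adj g c a].
  move=> L; rewrite /other /=; case: pickP => [a /andP[ab ca]|H]; first by exists a.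
  have /negP[] := noI (b, c); rewrite /isolated_edge_at L /=; apply/leaf_atP => v.
  by have /= := H v; have [-> _|//] := eqVneq v b; rewrite adjC (leaf_at_adj L).
rewrite -(card_in_imset (f := other)).
  apply: subset_leq_card; apply/subsetP => ab /imsetP[[b c]]; rewrite !inE => L ->.
  have [a [-> ab' ca]] := otherP _ _ L; rewrite /=.
  apply/andP; split; last first.
    apply/negP; rewrite adjC => /(leaf_at_nbr L) ac; by move: ca; rewrite ac adj_irr.
  by apply/dominatesP; split => // v /(leaf_at_nbr L) -> _; rewrite adjC.
move=> [b c] [b' c']; rewrite !inE => L L'.
have [a [-> _ _]] := otherP _ _ L; have [a' [-> _ _]] := otherP _ _ L'.
by case=> _ bb; move: L'; rewrite -bb => /leaf_at_adj /(leaf_at_nbr L) ->.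
Qed.

Lemma isolated_nonadj_dom g b : isolated_at b g -> (m < n_nonadj_dom g)%N.
Proof.
move/isolated_atP => I; rewrite n_nonadj_domE.
apply: (@leq_trans #|~: [set b]|); first by rewrite cardC1_ord.
have fI : injective (fun a => (a, b)) by move=> x y [].
rewrite -(card_imset _ fI); apply: subset_leq_card.
apply/subsetP => ab /imsetP[a]; rewrite !inE => ab' -> /=.
rewrite adjC (negbTE (I a)) andbT; apply/dominatesP; split => // v bv.
by have := I v; rewrite bv.
Qed.

End Stars.

(** * Bounds for fixed n *)

Section Bounds.
Context {R : realType} {m : nat}.
Local Notation n := m.+2.
Implicit Types (p C : R) (g : graph n) (a b c v : 'I_n) (J K : {set 'I_n}).

Lemma prob_isolated p b : gnp_prob p (isolated_at b) = (1 - p) ^+ m.+1.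
Proof.
rewrite prob_cyl; last by rewrite disjoints_subset sub0set.
by rewrite cards0 expr0 mul1r card_star ?cardC1_ord // !inE eqxx.
Qed.

Lemma prob_leaf p b c : b != c -> gnp_prob p (leaf_at (b, c)) = p * (1 - p) ^+ m.
Proof.
move=> bc; rewrite /leaf_at /= bc /= prob_cyl; last first.
  rewrite disjoints_subset sub1set inE; apply/imsetP => -[v].
  rewrite !inE negb_or => /andP[vb vc] /(edge_of_inj bc).
  rewrite eq_sym vb => /(_ isT)/orP[/andP[_ /eqP E]|/andP[/eqP E _]].
    by rewrite E eqxx in vc.
  by rewrite E eqxx in vb.
by rewrite cards1 expr1 card_star ?cardC2_ord // !inE eqxx.
Qed.

Lemma prob_leaf_diag p b : gnp_prob p (leaf_at (b, b)) = 0.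
Proof. by rewrite /gnp_prob big_pred0 // => g; rewrite /leaf_at eqxx. Qed.

Definition leaf_mean p : R := (m.+2 * m.+1)%:R * (p * (1 - p) ^+ m).
Definition isolated_mean p : R := m.+2%:R * (1 - p) ^+ m.+1.

Lemma card_offdiag : #|[pred bc : 'I_n * 'I_n | bc.1 != bc.2]| = (m.+2 * m.+1)%N.
Proof.
rewrite -sum1_card big_mkcond /= -(pair_bigA _ (fun b c => if b != c then 1 else 0)%N) /=.
under eq_bigr => b _.
  rewrite -big_mkcond sum1_card (eq_card (B := ~: [set b])); last first.
    by move=> c; rewrite !inE eq_sym.
  rewrite cardC1_ord; over.
by rewrite sum_nat_const card_ord.
Qed.

Lemma leaf_meanE p : leaf_mean p = \sum_(bc : 'I_n * 'I_n) gnp_prob p (leaf_at bc).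
Proof.
rewrite (bigID [pred bc | bc.1 != bc.2]) /= [X in _ = _ + X]big1 ?addr0; last first.
  by move=> [b c] /=; rewrite negbK => /eqP ->; rewrite prob_leaf_diag.
rewrite (eq_bigr (fun=> p * (1 - p) ^+ m)); last by move=> [b c] /=; apply: prob_leaf.
by rewrite sumr_const card_offdiag /leaf_mean mulr_natl.
Qed.

Lemma isolated_meanE p : isolated_mean p = \sum_(b : 'I_n) gnp_prob p (isolated_at b).
Proof.
under eq_bigr do rewrite prob_isolated.
by rewrite sumr_const card_ord /isolated_mean mulr_natl.
Qed.

(** Each vertex forbids [m.+1] edges, and the edge [bc] is forbidden by both, so [2m + 1] edges are
    absent. *)
Lemma prob_isolatedI p b c : 0 <= p <= 1 -> b != c ->
  gnp_prob p (fun g => isolated_at b g && isolated_at c g) <= (1 - p) ^+ (m.*2).+1.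
Proof.
move=> hp bc; have [p0 p1] := andP hp.
have -> : gnp_prob p (fun g => isolated_at b g && isolated_at c g) =
  gnp_prob p (cyl (set0 :|: set0) (star b (~: [set b]) :|: star c (~: [set c]))).
  by apply: eq_bigl => g; rewrite -cylI.
apply: le_trans (prob_cyl_le _ _ hp) _; rewrite setU0 cards0 mul1r.
apply: ler_wiXn2l; [lra|lra|].
have := card_starU_ge (J := ~: [set b]) (K := ~: [set c]) bc.
rewrite !cardC1_ord !inE !eqxx => /(_ isT isT); lia.
Qed.

(** Both leaves require the same edge, while their forbidden stars avoid each other's centre and are
    disjoint, with [m] edges each. *)
Lemma prob_isolated_edge p b c : 0 <= p <= 1 ->
  gnp_prob p (isolated_edge_at (b, c)) <= p * (1 - p) ^+ m.*2.
Proof.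
move=> hp; have [p0 p1] := andP hp.
have [->|bc] := eqVneq b c.
  rewrite /gnp_prob big_pred0 ?mulr_ge0 ?exprn_ge0 ?subr_ge0 // => g.
  by rewrite /isolated_edge_at /leaf_at eqxx.
have -> : gnp_prob p (isolated_edge_at (b, c)) =
  gnp_prob p (cyl ([set edge_of b c] :|: [set edge_of c b])
    (star b (~: [set b; c]) :|: star c (~: [set c; b]))).
  by apply: eq_bigl => g; rewrite -cylI /isolated_edge_at /leaf_at /= bc eq_sym bc.
apply: le_trans (prob_cyl_le _ _ hp) _; rewrite (edge_ofC c) setUid cards1 expr1.
rewrite card_starU ?inE ?eqxx ?orbT // !cardC2_ord // 1?eq_sym //.
by rewrite addnn.
Qed.

(** If [b' = b] or [b' = c], two simultaneous leaves coincide or form an isolated edge, both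
    excluded by hypothesis. Otherwise the two required edges differ, and the forbidden stars, of [m]
    edges each, share at most the edge between the two leaves. *)
Lemma prob_leafI p b c b' c' : 0 <= p <= 1 -> (b', c') != (b, c) -> (b', c') != (c, b) ->
  gnp_prob p (fun g => leaf_at (b, c) g && leaf_at (b', c') g)
  <= p ^+ 2 * (1 - p) ^+ (m.*2).-1.
Proof.
move=> hp N1 N2; have [p0 p1] := andP hp.
have H0 : (forall g, ~~ (leaf_at (b, c) g && leaf_at (b', c') g)) ->
  gnp_prob p (fun g => leaf_at (b, c) g && leaf_at (b', c') g)
    <= p ^+ 2 * (1 - p) ^+ (m.*2).-1.
  move=> H; rewrite /gnp_prob big_pred0 ?mulr_ge0 ?exprn_ge0 ?subr_ge0 // => g.
  exact/negbTE.
have [bb|bb] := eqVneq b' b.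
  apply: H0 => g; apply/negP => /andP[L L']; move: N1; rewrite bb in L' *.
  by rewrite (leaf_at_nbr L (leaf_at_adj L')) eqxx.
have [bc|bc] := eqVneq b c.
  by apply: H0 => g; rewrite bc /leaf_at eqxx.
have [bc'|bc'] := eqVneq b' c'.
  by apply: H0 => g; rewrite bc' {2}/leaf_at eqxx andbF.
have [b'c|b'c] := eqVneq b' c.
  apply: H0 => g; apply/negP => /andP[L L'].
  have := leaf_at_adj L; rewrite adjC -b'c => /(leaf_at_nbr L') E.
  by move: N2; rewrite b'c E eqxx.
have -> : gnp_prob p (fun g => leaf_at (b, c) g && leaf_at (b', c') g) =
  gnp_prob p (cyl ([set edge_of b c] :|: [set edge_of b' c'])
    (star b (~: [set b; c]) :|: star b' (~: [set b'; c']))).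
  by apply: eq_bigl => g; rewrite -cylI /leaf_at /= bc bc'.
apply: le_trans (prob_cyl_le _ _ hp) _.
have -> : #|[set edge_of b c] :|: [set edge_of b' c']| = 2%N.
  rewrite cards2; case: eqP => // /(edge_of_inj bc bc').
  by rewrite [b == b']eq_sym (negbTE bb) [c == b']eq_sym (negbTE b'c) andbF.
apply: ler_wpM2l; first exact: exprn_ge0.
apply: ler_wiXn2l; [lra|lra|].
have := card_starU_ge (b := b) (c := b') (J := ~: [set b; c]) (K := ~: [set b'; c']).
rewrite !cardC2_ord // !inE !eqxx (eq_sym b) => /(_ bb isT isT); lia.
Qed.

(** With [mu] the mean, the diagonal pairs contribute [mu] to the second moment and the others at
    most [mu ^+ 2 / (1 - p)]. As [1 / (1 - p) = 1 + p / (1 - p)], the relative excess is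
    [1 / mu + p / (1 - p)]. *)
Lemma prob_no_isolated p : 0 <= p < 1 -> 2 <= isolated_mean p ->
  gnp_prob p (fun g : graph n => ~~ [exists b, isolated_at b g])
  <= 4 * (1 / isolated_mean p + p / (1 - p)).
Proof.
move=> /andP[p0 p1] mu2.
have hp : 0 <= p <= 1 by lra.
have mu0 : 0 < isolated_mean p by lra.
apply: le_trans (chebyshev_count hp (isolated_meanE p) (C := 1) _ mu0 _); last 2 first.
- have -> : isolated_mean p ^+ 2 * (1 + (1 / isolated_mean p + p / (1 - p))) =
    isolated_mean p + isolated_mean p ^+ 2 / (1 - p) by field; lra.
  pose q := (1 - p) ^+ (m.*2).+1.
  have q0 : 0 <= q by rewrite exprn_ge0 // subr_ge0 ltW.
  apply: (@le_trans _ _ (\sum_(b : 'I_n) (gnp_prob p (isolated_at b) + \sum_(c : 'I_n) q))).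
    apply: ler_sum => b _; rewrite (bigD1 b) //=; apply: lerD.
      by apply: gnp_prob_le => // g /andP[].
    rewrite [leRHS](bigD1 b) //=; apply: ler_wpDl => //; apply: ler_sum => c cb.
    by apply: prob_isolatedI => //; rewrite eq_sym.
  rewrite big_split /= -isolated_meanE lerD2l !sumr_const card_ord.
  rewrite -(mulr_natl (q *+ _)) -(mulr_natl q) /q /isolated_mean le_eqVlt; apply/orP; left; apply/eqP.
  rewrite -addnn -addnS exprD !exprS; field; lra.
- lra.
apply: gnp_prob_le => // g; rewrite negb_exists => /forallP H.
by rewrite big1 // => b _; rewrite (negbTE (H b)).
Qed.

(** As for isolated vertices, except that each pair correlates both with itself and with its
    reversal (an isolated edge), whence [2 / leaf_mean p]. The hypothesis [0 < m] makes the
    truncated [(m.*2).-1] equal to [2m - 1]. *)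
Lemma prob_few_leaves p C : (0 < m)%N -> 0 <= p < 1 -> 0 < leaf_mean p ->
  2 * C <= leaf_mean p ->
  gnp_prob p (fun g : graph n => (\sum_bc (leaf_at bc g : nat))%:R < C)
  <= 4 * (2 / leaf_mean p + p / (1 - p)).
Proof.
move=> m0 /andP[p0 p1] mu0 muC.
have hp : 0 <= p <= 1 by lra.
apply: (chebyshev_count hp (leaf_meanE p) _ mu0 muC).
have -> : leaf_mean p ^+ 2 * (1 + (2 / leaf_mean p + p / (1 - p))) =
    leaf_mean p + leaf_mean p + leaf_mean p ^+ 2 / (1 - p) by field; lra.
pose q := p ^+ 2 * (1 - p) ^+ (m.*2).-1.
have q0 : 0 <= q by rewrite mulr_ge0 ?exprn_ge0 // subr_ge0 ltW.
pose P i := gnp_prob p (@leaf_at m i).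
have P0 i : 0 <= P i by apply: gnp_prob_ge0.
(* Summing over off-diagonal pairs only keeps the count at [n (n - 1)], which matches [leaf_mean]
   exactly. *)
pose od (i : 'I_n * 'I_n) : R := (i.1 != i.2)%:R.
have od0 i : 0 <= od i by apply: ler0n.
have od_sum : \sum_i od i = (m.+2 * m.+1)%:R.
  rewrite /od -natr_sum -card_offdiag -sum1_card [in RHS]big_mkcond /=.
  by congr _%:R; apply: eq_bigr => i _; rewrite inE /=; case: (_ != _).
apply: (@le_trans _ _ (\sum_i (P i + (P i + \sum_j od i * od j * q)))).
  apply: ler_sum => -[b c] _; rewrite (bigD1 (b, c)) //=; apply: lerD.
    by apply: gnp_prob_le => // g /andP[].
  have [bc|bc] := eqVneq b c.
    rewrite big1 => [|j _].
      apply: addr_ge0; first exact: P0.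
      apply: sumr_ge0 => j _; apply: mulr_ge0 => //; exact: mulr_ge0.
    by rewrite /gnp_prob big_pred0 // => g; rewrite /leaf_at /= bc eqxx.
  have swn : (c, b) != (b, c) by rewrite xpair_eqE negb_and eq_sym bc.
  rewrite (bigD1 (c, b)) //=; apply: lerD.
    by apply: gnp_prob_le => // g /andP[].
  rewrite [leRHS](bigID (fun j => (j != (b, c)) && (j != (c, b)))) /=.
  apply: ler_wpDr; first by apply: sumr_ge0 => j _; apply: mulr_ge0 => //; exact: mulr_ge0.
  apply: ler_sum => -[b' c'] /andP[N1 N2].
  rewrite /od /= bc mul1r; have [bc'|bc'] /= := eqVneq b' c'.
    rewrite mul0r /gnp_prob big_pred0 // => g.
    by rewrite [leaf_at (b', c') g]/leaf_at /= bc' eqxx andbF.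
  by rewrite mul1r; apply: prob_leafI.
rewrite !big_split /= -leaf_meanE addrA lerD2l.
under eq_bigr do rewrite -mulr_suml -mulr_sumr.
rewrite -!mulr_suml od_sum /q /leaf_mean le_eqVlt; apply/orP; left; apply/eqP.
case: m m0 => // k _; rewrite doubleS /= -addnn !exprS exprD; field; lra.
Qed.

Lemma prob_some_isolated_edge p : 0 <= p <= 1 ->
  gnp_prob p (fun g : graph n => [exists bc, isolated_edge_at bc g])
  <= n%:R ^+ 2 * (p * (1 - p) ^+ m.*2).
Proof.
move=> hp; have [p0 p1] := andP hp.
apply: le_trans (gnp_prob_union_const (A := predT) (Q := isolated_edge_at) hp _
  (c := p * (1 - p) ^+ m.*2) _) _.
- by move=> g /existsP[bc h]; exists bc.
- by move=> [b c] _; apply: prob_isolated_edge.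
by rewrite card_prod card_ord natrM expr2.
Qed.

Lemma prob_adj_dom p : 0 <= p <= 1 ->
  gnp_prob p (fun g : graph n => n_adj_dom g != 0%N) <= n%:R ^+ 2 * p.
Proof.
move=> hp; have [p0 p1] := andP hp.
apply: le_trans (gnp_prob_union_const (A := [pred ab : 'I_n * 'I_n | ab.1 != ab.2])
  (Q := fun ab => cyl [set edge_of ab.1 ab.2] set0) hp _ (c := p) _) _.
- move=> g; rewrite n_adj_domE -lt0n => /card_gt0P[[a b]].
  rewrite inE /= => /andP[/dominatesP[ab _] adjab]; exists (a, b) => //=.
  by rewrite /cyl sub0set andbT sub1set -adjE.
- move=> ab _; apply: le_trans (prob_cyl_le _ _ hp) _.
  by rewrite cards1 cards0 expr1 mulr1.
rewrite card_offdiag -natrX; apply: ler_wpM2r => //.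
by rewrite ler_nat leq_mul.
Qed.

End Bounds.

(** * Configurations forced by a domination pair, and their expected numbers *)

Section DominationBound.
Context {R : realType} {m : nat}.
Local Notation n := m.+2.
Implicit Types (p C : R) (g : graph n) (a b c v w : 'I_n) (J K : {set 'I_n}).

(** A triangle in which [b] has degree 2; [a] and [c] may have further neighbours. *)
Definition triangle_at (t : 'I_n * 'I_n * 'I_n) : pred (graph n) :=
  let: (a, b, c) := t in
  cyl [set edge_of a b; edge_of b c; edge_of a c] (star b (~: [set a; b; c])).

Lemma prob_triangle p a b c : 0 <= p <= 1 -> a != b -> a != c -> b != c ->
  gnp_prob p (triangle_at (a, b, c)) <= p ^+ 3 * (1 - p) ^+ m.-1.
Proof.
move=> hp ab ac bc; apply: le_trans (prob_cyl_le _ _ hp) _.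
rewrite card_star ?cardC3_ord //; last by rewrite !inE eqxx orbT.
have -> // : #|[set edge_of a b; edge_of b c; edge_of a c]| = 3%N.
have neq x y z w : x != y -> z != w -> x != z -> x != w -> edge_of x y != edge_of z w.
  move=> xy zw xz xw; apply/eqP => /(edge_of_inj xy zw).
  by rewrite (negbTE xz) (negbTE xw).
have ba : b != a by rewrite eq_sym.
have cb : c != b by rewrite eq_sym.
have ca : c != a by rewrite eq_sym.
have acab : edge_of a c != edge_of a b by rewrite (edge_ofC a c); apply: neq.
have acbc : edge_of a c != edge_of b c by apply: neq.
have abbc : edge_of a b != edge_of b c by apply: neq.
by rewrite setUC cardsU1 cards2 !inE negb_or acab acbc abbc.
Qed.

(* [J] is the set of neighbours of [b] other than [a]. *)
Definition dom_via a b J : pred (graph n) :=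
  cyl (star b J :|: star a J) (star b (~: (J :|: [set a; b]))).

(** [v] and [w] witness that [J] has at least two elements. Whether [a] and [b] are adjacent is left
    open, which covers both kinds of pairs. *)
Definition dom_two_at (t : 'I_n * 'I_n * 'I_n * 'I_n) : pred (graph n) := fun g =>
  let: (a, b, v, w) := t in
  [exists J : {set 'I_n}, [&& v \in J, w \in J, J \subset ~: [set a; b] & dom_via a b J g]].

Lemma prob_dom_via p a b J : 0 <= p <= 1 -> a != b -> J \subset ~: [set a; b] ->
  gnp_prob p (dom_via a b J)
  <= (p ^+ 2) ^+ #|J| * (1 - p) ^+ #|~: (J :|: [set a; b])|.
Proof.
move=> hp ab Jab; apply: le_trans (prob_cyl_le _ _ hp) _.
have [aJ bJ] : a \notin J /\ b \notin J.
  by split; apply/negP => /(subsetP Jab); rewrite !inE eqxx ?orbT.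
rewrite card_starU 1?eq_sym // card_star; last by rewrite !inE eqxx !orbT.
by rewrite -exprM mul2n addnn.
Qed.

(** The union bound over [J] is summed in closed form by distributivity: [v] and [w] contribute
    [p ^+ 2] each, and every other vertex outside [a], [b] contributes [p ^+ 2] as a common
    neighbour or [1 - p] as a non-neighbour of [b]. *)
Lemma prob_dom_two p a b v w : 0 <= p <= 1 -> uniq [:: a; b; v; w] ->
  gnp_prob p (dom_two_at (a, b, v, w))
  <= (p ^+ 2) ^+ 2 * (p ^+ 2 + (1 - p)) ^+ m.-2.
Proof.
move=> hp U; have [p0 p1] := andP hp.
move: (U); rewrite /= !inE !negb_or !andbT => /and3P[/and3P[ab av aw] /andP[bv bw] vw].
pose cond J := [&& v \in J, w \in J & J \subset ~: [set a; b]].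
apply: le_trans (gnp_prob_union (A := cond) (Q := dom_via a b) hp _) _.
  by move=> g /existsP[J /and4P[h1 h2 h3 h4]]; exists J => //; apply/and3P.
(* [F] and [G] are the factors of a vertex inside and outside [J]; their zeros exclude [a], [b] from
   [J] and force [v], [w] into it. *)
pose F u := if u \in [set a; b] then 0 else p ^+ 2.
pose G u := if u \in [set a; b] then 1 else if u \in [set v; w] then 0 else 1 - p.
apply: (@le_trans _ _ (\sum_(J : {set 'I_n}) \prod_u (if u \in J then F u else G u))).
  rewrite big_mkcond; apply: ler_sum => J _ /=.
  have FG0 u : 0 <= (if u \in J then F u else G u).
    by rewrite /F /G; do !case: ifP => _; rewrite ?exprn_ge0 ?subr_ge0.
  case: ifP => [/and3P[vJ wJ Jab]|_]; last exact: prodr_ge0.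
  apply: le_trans (prob_dom_via hp ab Jab) _.
  rewrite le_eqVlt; apply/orP; left; apply/eqP.
  rewrite [RHS](bigID (mem J)) /=; congr (_ * _).
    rewrite (eq_bigr (fun=> p ^+ 2)) ?prodr_const // => u uJ.
    by rewrite uJ /F; have := subsetP Jab u uJ; rewrite in_setC => /negbTE ->.
  rewrite (bigID (mem [set a; b])) /= big1 ?mul1r; last first.
    by move=> u /andP[/negbTE -> h]; rewrite /G h.
  rewrite (eq_bigr (fun=> 1 - p)) => [|u /andP[uJ uab]].
    rewrite prodr_const; congr (_ ^+ _); apply: eq_card => u; by rewrite [RHS]unfold_in /= !inE negb_or.
  rewrite (negbTE uJ) /G (negbTE uab) ifF //; apply/negP; rewrite !inE.
  by case/orP => /eqP uE; move: uJ; rewrite uE ?vJ ?wJ.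
rewrite -bigA_distr (bigID (mem [set a; b])) /= big1 ?mul1r; last first.
  by move=> u h; rewrite /F /G h add0r.
rewrite (bigID (mem [set v; w])) /=.
rewrite (eq_bigr (fun=> p ^+ 2)); last first.
  by move=> u /andP[/negbTE h1 h2]; rewrite /F /G h1 h2 addr0.
rewrite [X in _ * X](eq_bigr (fun=> p ^+ 2 + (1 - p))); last first.
  by move=> u /andP[/negbTE h1 /negbTE h2]; rewrite /F /G h1 h2.
rewrite !prodr_const le_eqVlt; apply/orP; left; apply/eqP; congr (_ ^+ _ * _ ^+ _).
  transitivity #|[set v; w]|; last by rewrite cards2 vw.
  apply: eq_card => u; rewrite unfold_in /= !inE negb_or.
  have [->|_] := eqVneq u v; first by rewrite !(eq_sym v) av bv.
  by have [->|_] := eqVneq u w; rewrite ?andbF // !(eq_sym w) aw bw.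
transitivity #|~: [set x in [:: a; b; v; w]]|; last first.
  by rewrite cardsCs setCK cardsE (card_uniqP U) card_ord /= !subSS subn2.
by apply: eq_card => u; rewrite unfold_in /= !inE !negb_or -!andbA.
Qed.

(** By the number of neighbours of [b] other than [a]. If there is none, [b] is isolated or a leaf
    at [a]; if there is one, [b] is a leaf or, when adjacent to [a], lies in a triangle; otherwise
    two of them serve as [v] and [w]. *)
Lemma dominates_cases g a b : dominates g a b ->
  [|| isolated_at b g, [exists bc, leaf_at bc g],
   [exists t, [&& t.1.1 != t.1.2, t.1.1 != t.2, t.1.2 != t.2 & triangle_at t g]] |
   [exists t, uniq [:: t.1.1.1; t.1.1.2; t.1.2; t.2] && dom_two_at t g]].
Proof.
case/dominatesP => ab dab.
pose J := [set v | adj g b v && (v != a)].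
have JP v : v \in J = adj g b v && (v != a) by rewrite inE.
have bJ : b \notin J by rewrite JP adj_irr.
have aJ : a \notin J by rewrite JP eqxx andbF.
have J_adj v : v \in J -> adj g b v /\ adj g a v.
  by rewrite JP => /andP[bv va]; split => //; apply: dab.
have [J0|] := posnP #|J|.
  move/cards0_eq in J0.
  have nb v : adj g b v -> v = a.
    by move=> bv; apply/eqP; have := in_set0 v; rewrite -J0 JP bv /= => /negbFE.
  have [ba|nba] := boolP (adj g b a).
    apply/or4P; apply: Or42; apply/existsP; exists (b, a); apply/leaf_atP => v.
    by apply/idP/eqP => [/nb//|->].
  apply/or4P; apply: Or41; apply/isolated_atP => v.
  by apply: contra nba => bv; rewrite -(nb v bv).
rewrite leq_eqVlt => /orP[/eqP/esym/eqP/cards1P[c Jc]|].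
  have := JP c; rewrite Jc set11 => /esym/andP[bc ca].
  have nb v : adj g b v -> v != a -> v = c.
    by move=> bv va; apply/eqP; have := JP v; rewrite Jc bv va in_set1.
  have cb : b != c by apply: contraTneq bc => ->; rewrite adj_irr.
  have [ba|nba] := boolP (adj g b a); last first.
    apply/or4P; apply: Or42; apply/existsP; exists (b, c); apply/leaf_atP => v.
    apply/idP/eqP => [bv|-> //]; apply: nb => //.
    by apply: contraNneq nba => <-.
  apply/or4P; apply: Or43; apply/existsP; exists (a, b, c) => /=.
  rewrite ab eq_sym ca cb /=; apply/andP; split.
    rewrite !subUset !sub1set -!adjE // 1?eq_sym // adjC ba bc /=.
    by apply: dab.
  apply/star_subCP; first by rewrite !inE eqxx !orbT.
  move=> v; rewrite !inE !negb_or => /andP[/andP[va vb] vc].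
  by apply/negP => bv; move: vc; rewrite (nb v bv va) eqxx.
case/card_gt1P => v [w [vJ wJ vw]].
have [bv av] := J_adj v vJ; have [bw aw] := J_adj w wJ.
have adjN x y : adj g x y -> x != y by apply: contraTneq => ->; rewrite adj_irr.
apply/or4P; apply: Or44; apply/existsP; exists (a, b, v, w); apply/andP; split.
  by rewrite /= !inE !negb_or ab vw !adjN.
apply/existsP; exists J; rewrite vJ wJ /=; apply/andP; split.
  apply/subsetP => u uJ; rewrite !inE negb_or.
  by rewrite (contraTneq _ uJ) ?(contraTneq _ uJ) // => ->.
apply/andP; split.
  by rewrite subUset; apply/andP; split; apply/star_subP => // u /J_adj[].
apply/star_subCP; first by rewrite !inE eqxx !orbT.
move=> u; rewrite in_setC in_setU negb_or JP !inE !negb_or => /and3P[+ ua _].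
by rewrite ua andbT.
Qed.

(** One term for each case of [dominates_cases], in that order; the power of [n] bounds the number
    of vertex tuples. *)
Definition dom_bound p : R :=
  n%:R * (1 - p) ^+ m.+1 + n%:R ^+ 2 * (p * (1 - p) ^+ m)
  + n%:R ^+ 3 * (p ^+ 3 * (1 - p) ^+ m.-1)
  + n%:R ^+ 4 * ((p ^+ 2) ^+ 2 * (p ^+ 2 + (1 - p)) ^+ m.-2).

Lemma prob_dom_le p : 0 <= p <= 1 ->
  gnp_prob p (fun g : graph n => ~~ ((n_adj_dom g == 0%N) && (n_nonadj_dom g == 0%N)))
  <= dom_bound p.
Proof.
move=> hp; have [p0 p1] := andP hp; have q0 : 0 <= 1 - p by lra.
pose E1 g := [exists b, isolated_at b g].
pose E2 g := [exists bc : 'I_n * 'I_n, leaf_at bc g].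
pose E3 g := [exists t : 'I_n * 'I_n * 'I_n,
  [&& t.1.1 != t.1.2, t.1.1 != t.2, t.1.2 != t.2 & triangle_at t g]].
pose E4 g := [exists t : 'I_n * 'I_n * 'I_n * 'I_n,
  uniq [:: t.1.1.1; t.1.1.2; t.1.2; t.2] && dom_two_at t g].
apply: (@le_trans _ _ (gnp_prob p (fun g => (((E1 g) || (E2 g)) || (E3 g)) || (E4 g)))).
  apply: gnp_prob_le => // g bad.
  have [a [b dab]] : exists a b, dominates g a b.
    move: bad; rewrite negb_and -!lt0n n_adj_domE n_nonadj_domE.
    by case/orP => /card_gt0P[[a b]]; rewrite inE => /andP[/= dab _]; exists a, b.
  case/or4P: (dominates_cases dab) => h; rewrite ?orbT //.
  - by have -> : E1 g by apply/existsP; exists b.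
  - by rewrite /E2 h ?orbT.
  - by rewrite /E3 h ?orbT.
  - by rewrite /E4 h ?orbT.
rewrite /dom_bound.
apply: le_trans (gnp_prob_or _ _ hp) _; apply: lerD.
  apply: le_trans (gnp_prob_or _ _ hp) _; apply: lerD.
    apply: le_trans (gnp_prob_or _ _ hp) _; apply: lerD.
      apply: le_trans (gnp_prob_union_const (A := predT) (Q := isolated_at) hp _
        (c := (1 - p) ^+ m.+1) _) _.
      - by move=> g /existsP[b h]; exists b.
      - by move=> b _; rewrite prob_isolated.
      by rewrite card_ord.
    apply: le_trans (gnp_prob_union_const (A := predT) (Q := leaf_at) hp _
        (c := p * (1 - p) ^+ m) _) _.
    - by move=> g /existsP[b h]; exists b.
    - move=> [b c] _; have [->|bc] := eqVneq b c; last by rewrite prob_leaf.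
      by rewrite prob_leaf_diag mulr_ge0 ?exprn_ge0.
    by rewrite card_prod card_ord -natrX.
  apply: le_trans (gnp_prob_union_const (Q := triangle_at) (A := [pred t |
    [&& t.1.1 != t.1.2, t.1.1 != t.2 & t.1.2 != t.2]]) hp _
    (c := p ^+ 3 * (1 - p) ^+ m.-1) _) _.
  - by move=> g /existsP[t /and4P[h1 h2 h3 h4]]; exists t => //; apply/and3P.
  - by move=> [[a b] c] /and3P[/= ab ac bc]; apply: prob_triangle.
  apply: ler_wpM2r; first by rewrite mulr_ge0 ?exprn_ge0.
  rewrite -natrX ler_nat; apply: leq_trans (max_card _) _.
  by rewrite !card_prod card_ord !expnS expn0 muln1 mulnA.
apply: le_trans (gnp_prob_union_const (Q := dom_two_at) (A := [pred t |
  uniq [:: t.1.1.1; t.1.1.2; t.1.2; t.2]]) hp _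
  (c := (p ^+ 2) ^+ 2 * (p ^+ 2 + (1 - p)) ^+ m.-2) _) _.
- by move=> g /existsP[t /andP[h1 h2]]; exists t.
- by move=> [[[a b] v] w] U; apply: prob_dom_two.
apply: ler_wpM2r; first by rewrite mulr_ge0 ?exprn_ge0 // addr_ge0 ?exprn_ge0.
rewrite -natrX ler_nat; apply: leq_trans (max_card _) _.
by rewrite !card_prod card_ord !expnS expn0 muln1 !mulnA.
Qed.

End DominationBound.

(** * Asymptotic estimates *)

Section ExpEstimates.
Context {R : realType}.
Implicit Types (p t x w eps M : R).

Lemma expR_ge_pow k x : 0 <= x -> x ^+ k.+1 / k.+1`!%:R <= expR x.
Proof. by move=> x0; apply: le_trans (expR_ge1Dxn k x0); rewrite lerDr. Qed.

Lemma expR_le_mulN c x y : 0 <= c -> x <= y -> c * expR (- y) <= c * expR (- x).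
Proof. by move=> c0 xy; rewrite ler_wpM2l // ler_expR lerN2. Qed.

Lemma onem_exp_le p k : p <= 1 -> (1 - p) ^+ k <= expR (- (k%:R * p)).
Proof.
move=> p1; rewrite -mulrN expRM_natl lerXn2r ?nnegrE ?subr_ge0 ?expR_ge0 //.
exact: expR_ge1Dx.
Qed.

(** From [1 / (1 - p) = 1 + p / (1 - p) <= expR (p / (1 - p))] and [p / (1 - p) <= p + 2 * p ^+ 2].
    After raising to the power [k <= N], the quadratic term costs at most a factor [e]. *)
Lemma onem_exp_ge p k N : 0 <= p <= 1 / 2 -> k%:R <= N -> 2 * N * p ^+ 2 <= 1 ->
  expR (- (N * p) - 1) <= (1 - p) ^+ k.
Proof.
move=> /andP[p0 p2] kN Np.
have h : expR (- p - 2 * p ^+ 2) <= 1 - p.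
  have q0 : 0 < 1 - p by lra.
  have := expR_ge1Dx (p / (1 - p)); have -> : 1 + p / (1 - p) = (1 - p)^-1 by field; lra.
  move=> H.
  have : expR (- (p / (1 - p))) <= 1 - p.
    by rewrite expRN -[leRHS]invrK lef_pV2 ?posrE ?invr_gt0 ?expR_gt0.
  apply: le_trans; rewrite ler_expR.
  have : p / (1 - p) <= p + 2 * p ^+ 2; last by lra.
  rewrite ler_pdivrMr //; nra.
apply: (@le_trans _ _ (expR (- p - 2 * p ^+ 2) ^+ k)); last first.
  by rewrite lerXn2r ?nnegrE ?expR_ge0 //; lra.
rewrite -expRM_natl ler_expR; have k0 : 0 <= k%:R :> R by [].
have := sqr_ge0 p; nra.
Qed.

(* [N x e^-x], with [N = e^t], is unimodal in [x]; the three cases are the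
   increasing branch, its middle, and the end near [t + ln t]. *)
Lemma mul_expRN_ge t x w M : 1 <= t -> 0 <= x <= t + ln t - w ->
  M * expR 1 <= expR t * x -> M <= expR (t / 2) -> 2 * M <= w ->
  M <= expR t * x * expR (- x).
Proof.
move=> t1 /andP[x0 xw] M1 M2 M3; have t0 : 0 < t by lra.
have et := expR_gt0 t; have [x1|x1] := leP x 1.
  apply: (@le_trans _ _ (expR t * x * expR (- 1))).
    by rewrite expRN ler_pdivlMr ?expR_gt0.
  by apply: expR_le_mulN => //; rewrite mulr_ge0 // ltW.
have [x2|x2] := leP x (t / 2).
  apply: le_trans M2 _; rewrite mulrAC -expRD.
  apply: (@le_trans _ _ (expR (t - x))); first by rewrite ler_expR; lra.
  by rewrite ler_peMr ?expR_ge0 // ltW.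
(* Here [x / t >= 1 / 2], and [t * expR (t - x)] is the exponential of [t + ln t - x >= w], hence at
   least [w >= 2 * M]. *)
have -> : expR t * x * expR (- x) = x / t * (t * expR (t - x)).
  by rewrite expRD; field; lra.
have h : w <= t * expR (t - x).
  rewrite -{1}(lnK (x := t)) ?posrE // -expRD; apply: le_trans (expR_ge1Dx _).
  lra.
have : 1 / 2 <= x / t by rewrite ler_pdivlMr //; lra.
have : 0 <= t * expR (t - x) by rewrite mulr_ge0 ?expR_ge0 // ltW.
nra.
Qed.

(** With [x = t + ln t + y] the left side is [x / t * expR (- y)]. Since [x / t <= 2 + y] and
    [w <= y], the claim follows from [(2 + y) * y <= 6 * (1 + y ^+ 2 / 2) <= 6 * expR y]. *)
Lemma mul_expRN_le t x w : 1 <= t -> 0 < w -> t + ln t + w <= x ->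
  expR t * x * expR (- x) <= 6 / w.
Proof.
move=> t1 w0 xw; have t0 : 0 < t by lra.
have lt : ln t <= t by apply/ltW/ln_sublinear.
have [y yE] : exists y, y = x - t - ln t by exists (x - t - ln t).
have yw : w <= y by lra.
have -> : expR t * x * expR (- x) = x / t * expR (- y).
  have -> : - x = - t + (- ln t + - y) by rewrite yE; ring.
  rewrite !expRD expRN (expRN (ln t)) lnK ?posrE //; field.
  by rewrite !gt_eqF ?expR_gt0.
have ey := expR_gt0 y.
have xt : x / t <= 2 + y.
  have : y <= y * t by rewrite ler_peMr //; lra.
  by rewrite ler_pdivrMr //; lra.
rewrite expRN ler_pdivrMr // mulrAC ler_pdivlMr //.
have := expR_ge1Dxn 1 (x := y); rewrite (_ : 2`! = 2)%N // => /(_ _) h.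
have {}h : 1 + y ^+ 2 / 2 <= expR y by apply: h; lra.
have y0 : 0 < y by lra.
have : x / t * w <= (2 + y) * y.
  apply: ler_pM => //; [|exact: ltW].
  rewrite divr_ge0 //; last exact: ltW.
  have := ln_ge0 t1; lra.
nra.
Qed.

End ExpEstimates.

(** * Explicit bounds in terms of [N = n] and [t = log n] *)

Section Pointwise.
Context {R : realType} {m : nat}.
Implicit Types (p C eps w : R).
Local Notation n := m.+2.
Context (N t : R) (NE : N = m.+2%:R) (expRt : expR t = N).

Let N2 : 2 <= N. Proof. by rewrite NE ler_nat. Qed.

(** The factor 2 pays for [N - 1 >= N / 2], the factor [e] for the loss in [onem_exp_ge]. *)
Lemma leaf_mean_ge p : 0 <= p <= 1 / 2 -> 2 * N * p ^+ 2 <= 1 ->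
  N * (N * p) * expR (- (N * p)) <= 2 * expR 1 * leaf_mean (m := m) p.
Proof.
have n2 := N2.
move=> hp h; have [p0 _] := andP hp.
have H := onem_exp_ge hp (k := m) (N := N) _ h.
have {}H : expR (- (N * p) - 1) <= (1 - p) ^+ m by apply: H; rewrite NE ler_nat; lia.
rewrite /leaf_mean natrM -NE.
have -> : m.+1%:R = N - 1 :> R by rewrite NE (mulrS _ m.+1) addrAC subrr add0r.
have -> : expR (- (N * p)) = expR 1 * expR (- (N * p) - 1).
  by rewrite -expRD; congr expR; ring.
have e0 := expR_gt0 (1 : R).
have -> : N * (N * p) * (expR 1 * expR (- (N * p) - 1)) =
  2 * expR 1 * ((N * N / 2) * (p * expR (- (N * p) - 1))) by field.
apply: ler_wpM2l; first by rewrite mulr_ge0 // ltW.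
have NN : N * N / 2 <= N * (N - 1) by nra.
apply: ler_pM => //; [nra|by rewrite mulr_ge0 ?expR_ge0|].
by rewrite ler_wpM2l.
Qed.

Lemma isolated_mean_ge p : 0 <= p <= 1 / 2 -> 2 * N * p ^+ 2 <= 1 ->
  N * expR (- (N * p)) <= expR 1 * isolated_mean (m := m) p.
Proof.
have n2 := N2.
move=> hp h; have [p0 _] := andP hp.
have H := onem_exp_ge hp (k := m.+1) (N := N) _ h.
have {}H : expR (- (N * p) - 1) <= (1 - p) ^+ m.+1 by apply: H; rewrite NE ler_nat; lia.
have -> : expR (- (N * p)) = expR 1 * expR (- (N * p) - 1).
  by rewrite -expRD; congr expR; ring.
rewrite /isolated_mean -NE mulrCA ler_wpM2l ?expR_ge0 // ler_wpM2l //; lra.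
Qed.

(** Here [N * p <= 2 * t], while [N = expR t] is at least [t ^+ 2 / 2] and [t ^+ 3 / 6]; the latter
    exceeds [8 * t ^+ 2] once [t >= 48]. *)
Lemma sparse_small p : 48 <= t -> 0 <= p -> N * p <= t + ln t ->
  p <= 4 / t /\ 2 * N * p ^+ 2 <= 1.
Proof.
have n2 := N2.
move=> t48 p0 xp; have t0 : 0 < t by lra.
have lt : ln t <= t by apply/ltW/ln_sublinear.
have h2 := expR_ge_pow 1 (ltW t0); have h3 := expR_ge_pow 2 (ltW t0).
rewrite expRt (_ : 2`! = 2)%N // in h2; rewrite expRt (_ : 3`! = 6)%N // in h3.
have pt : p <= 4 / t.
  rewrite ler_pdivlMr //.
  have : p * t ^+ 2 <= 4 * t by nra.
  by rewrite expr2 mulrA ler_pM2r.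
split=> //.
have : (2 * N * p ^+ 2) * N <= 8 * t ^+ 2.
  have -> : 2 * N * p ^+ 2 * N = 2 * (N * p) ^+ 2 by ring.
  have : 0 <= N * p by rewrite mulr_ge0 //; lra.
  nra.
have : 8 * t ^+ 2 <= N.
  apply: le_trans h3; rewrite exprSr; have := sqr_ge0 t; nra.
nra.
Qed.

(** [M] is chosen so that [leaf_mean p >= 2 * C + 16 / eps]. Then [2 / leaf_mean p] and
    [p / (1 - p)] are each at most [eps / 8], and [prob_few_leaves] multiplies their sum by 4. *)
Lemma prob_few_leaves_le p C eps w M :
  M = 2 * expR 1 * (2 * C + 16 / eps) ->
  0 < eps -> 0 < C -> 0 <= p -> 48 <= t -> 64 / eps <= t -> 2 * M <= t -> 2 * M <= w ->
  N * p <= t + ln t - w -> M * expR 1 <= N * (N * p) ->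
  gnp_prob p (fun g : graph n => (\sum_bc (leaf_at bc g : nat))%:R < C) <= eps.
Proof.
have n2 := N2.
move=> ME e0 C0 p0 t48 te tM wM xw MN.
have E1 := expR_gt0 (1 : R).
have i0 : 0 < 16 / eps by rewrite divr_gt0.
have M0 : 0 < M by rewrite ME mulr_gt0 //; lra.
have t0 : 0 < t by lra.
have [pt Np] : p <= 4 / t /\ 2 * N * p ^+ 2 <= 1 by apply: sparse_small => //; lra.
have pe : p <= eps / 16.
  apply: le_trans pt _; rewrite ler_pdivrMr //.
  by move: te; rewrite ler_pdivrMr //; lra.
have p2 : p <= 1 / 2 by apply: le_trans pt _; rewrite ler_pdivrMr //; lra.
have hM : M <= N * (N * p) * expR (- (N * p)).
  rewrite -{1}expRt; apply: (@mul_expRN_ge _ t _ w) => //; rewrite ?expRt //; try lra.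
    by rewrite xw andbT mulr_ge0 //; lra.
  have := expR_ge1Dx (t / 2); lra.
have hp2 : 0 <= p <= 1 / 2 by rewrite p0.
have := le_trans hM (leaf_mean_ge hp2 Np); rewrite ME ler_pM2l ?mulr_gt0 // => mu.
have mu0 : 0 < leaf_mean (m := m) p by lra.
have m0 : (0 < m)%N.
  rewrite lt0n; apply/eqP => m0; have : t <= N by rewrite -expRt; have := expR_ge1Dx t; lra.
  by rewrite NE m0; lra.
have p01 : 0 <= p < 1 by apply/andP; split=> //; lra.
have muC : 2 * C <= leaf_mean (m := m) p by lra.
apply: le_trans (prob_few_leaves m0 p01 mu0 muC) _.
have : 2 / leaf_mean (m := m) p <= eps / 8.
  rewrite ler_pdivrMr // mulrC mulrA ler_pdivlMr //.
  have : 16 <= leaf_mean (m := m) p * eps by rewrite -ler_pdivrMr //; lra.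
  lra.
have : p / (1 - p) <= eps / 8 by rewrite ler_pdivrMr; nra.
lra.
Qed.

(** Because 3/4 is below 1, the mean is at least [expR (t / 4 - 1) >= t / 4], which is at least
    [2 + 8 / eps]. *)
Lemma prob_no_isolated_le p eps :
  0 < eps -> 0 <= p -> 48 <= t -> 64 / eps <= t -> 4 * (2 + 8 / eps) <= t ->
  N * p <= 3 / 4 * t ->
  gnp_prob p (fun g : graph n => ~~ [exists b, isolated_at b g]) <= eps.
Proof.
have n2 := N2.
move=> e0 p0 t48 te tM xt.
have i0 : 0 < 8 / eps by rewrite divr_gt0.
have t0 : 0 < t by lra.
have lt0 : 0 <= ln t by apply: ln_ge0; lra.
have [pt Np] : p <= 4 / t /\ 2 * N * p ^+ 2 <= 1 by apply: sparse_small => //; lra.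
have pe : p <= eps / 16.
  apply: le_trans pt _; rewrite ler_pdivrMr //.
  by move: te; rewrite ler_pdivrMr //; lra.
have p2 : p <= 1 / 2 by apply: le_trans pt _; rewrite ler_pdivrMr //; lra.
have hp2 : 0 <= p <= 1 / 2 by rewrite p0.
have h : t / 4 <= isolated_mean (m := m) p.
  have E1 := expR_gt0 (1 : R).
  rewrite -(ler_pM2l E1); apply: le_trans (isolated_mean_ge hp2 Np).
  rewrite -{1}expRt -expRD.
  have -> : t - N * p = 1 + (t - N * p - 1) by ring.
  rewrite [leRHS]expRD ler_pM2l //; apply: le_trans (expR_ge1Dx _); lra.
have p01 : 0 <= p < 1 by apply/andP; split=> //; lra.
have mu2 : 2 <= isolated_mean (m := m) p by lra.
apply: le_trans (prob_no_isolated p01 mu2) _.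
have mu0 : 0 < isolated_mean (m := m) p by lra.
have : 1 / isolated_mean (m := m) p <= eps / 8.
  rewrite ler_pdivrMr // mulrC mulrA ler_pdivlMr //.
  have : 8 <= isolated_mean (m := m) p * eps by rewrite -ler_pdivrMr //; lra.
  lra.
have : p / (1 - p) <= eps / 8 by rewrite ler_pdivrMr; nra.
lra.
Qed.

(** Because 3/4 exceeds 1/2, the factor [expR (- (2 * N * p))] beats [N]: the mean is at most
    [2 * t * expR 2 * expR (- (t / 2))], and [expR (t / 2) >= t ^+ 2 / 8]. The factor [expR 2] comes
    from [2m = 2N - 4] and [p <= 1 / 2]. *)
Lemma prob_isolated_edge_le p eps :
  0 < eps -> 0 <= p <= 1 / 2 -> 0 < t -> 16 * expR 2 / eps <= t ->
  3 / 4 * t <= N * p <= 2 * t ->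
  gnp_prob p (fun g : graph n => [exists bc, isolated_edge_at bc g]) <= eps.
Proof.
have n2 := N2.
move=> e0 /andP[p0 p2] t0 te /andP[x1 x2].
have hp : 0 <= p <= 1 by lra.
apply: le_trans (prob_some_isolated_edge hp) _.
apply: (@le_trans _ _ (N * (N * p) * expR (- (m.*2%:R * p)))).
  have -> : N * (N * p) * expR (- (m.*2%:R * p)) = N ^+ 2 * (p * expR (- (m.*2%:R * p))) by ring.
  rewrite -NE; apply: ler_wpM2l; first exact: sqr_ge0.
  by rewrite ler_wpM2l // onem_exp_le //; lra.
have -> : m.*2%:R = 2 * N - 4 :> R.
  by rewrite NE -muln2 natrM -[m.+2]addn2 natrD; ring.
apply: (@le_trans _ _ (N * (2 * t) * expR (2 - 3 / 2 * t))).
  apply: ler_pM; rewrite ?expR_ge0 //; first by rewrite !mulr_ge0 //; lra.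
    by rewrite ler_wpM2l //; lra.
  by rewrite ler_expR; lra.
have -> : N * (2 * t) * expR (2 - 3 / 2 * t) = 2 * t * expR 2 * expR (- (t / 2)).
  have -> : 2 - 3 / 2 * t = - t + (2 + - (t / 2)) by field.
  by rewrite -expRt !expRD (expRN t); field; rewrite gt_eqF ?expR_gt0.
rewrite expRN ler_pdivrMr ?expR_gt0 //.
have th : 0 <= t / 2 by lra.
have := expR_ge_pow 1 th; rewrite (_ : 2`! = 2)%N // => h.
apply: le_trans (ler_wpM2l (ltW e0) h).
move: te; rewrite ler_pdivrMr // => te; nra.
Qed.

(** Each power of [1 - p] misses at most four factors, which costs at most [expR 2]. The constants
    are [24 = 2 * 2 * 6] for the first two terms and [7728 = 2 * (24 + 3840)] for the last two,
    where 24 is [4!] and 3840 is [32 * 5!]. *)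
Lemma dom_bound_le p eps w : 0 < eps -> 0 <= p <= 1 / 2 -> 1 <= t -> 0 < w ->
  t + ln t + w <= N * p -> 24 * expR 2 / eps <= w -> 7728 * expR 2 / eps <= t ->
  dom_bound (m := m) p <= eps.
Proof.
have n2 := N2.
move=> e0 /andP[p0 p2] t1 w0 xw.
have lt0 : 0 <= ln t by apply: ln_ge0.
have [x xE] : exists x, x = N * p by exists (N * p).
have xt : t <= x by lra.
have x0 : 0 < x by lra.
have E2 := expR_gt0 (2 : R).
have qle k c : N - c <= k%:R -> c * p <= 2 -> (1 - p) ^+ k <= expR 2 * expR (- x).
  move=> kc cp; apply: le_trans (onem_exp_le _ _) _; first lra.
  by rewrite -expRD ler_expR xE; nra.
(* The isolated-vertex term is absorbed into the form of the leaf term, since [x >= t >= 1]. *)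
have H1 : N * (1 - p) ^+ m.+1 <= expR 2 * (N * x * expR (- x)).
  apply: (@le_trans _ _ (N * (expR 2 * expR (- x)))).
    apply: ler_wpM2l; first by rewrite ?exprn_ge0 //; lra.
    apply: (qle _ 1); last lra.
    by rewrite NE (mulrS _ m.+1); lra.
  have := expR_ge0 (- x); have : 0 <= N by lra.
  move=> h1 h2; have : 0 <= N * (expR 2 * expR (- x)) by rewrite !mulr_ge0 // ltW.
  nra.
have Ns (k : nat) : N - k%:R <= (m.+2 - k)%:R.
  have [km|km] := leqP k m.+2; first by rewrite NE natrB.
  by apply: le_trans (ler0n _ _); rewrite NE subr_le0 ler_nat ltnW.
have H2 : N ^+ 2 * (p * (1 - p) ^+ m) <= expR 2 * (N * x * expR (- x)).
  have -> : expR 2 * (N * x * expR (- x)) = N ^+ 2 * (p * (expR 2 * expR (- x))).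
    by rewrite {1}xE; ring.
  rewrite ler_wpM2l ?sqr_ge0 // ler_wpM2l //; apply: (qle _ 2); last lra.
  by have := Ns 2%N; rewrite subn2.
have H3 : N ^+ 3 * (p ^+ 3 * (1 - p) ^+ m.-1) <= expR 2 * (x ^+ 3 * expR (- x)).
  have -> : expR 2 * (x ^+ 3 * expR (- x)) = N ^+ 3 * (p ^+ 3 * (expR 2 * expR (- x))).
    by rewrite {1}xE; ring.
  have N0 : 0 <= N by lra.
  rewrite ler_wpM2l ?exprn_ge0 // ler_wpM2l ?exprn_ge0 //; apply: (qle _ 3); last lra.
  by have := Ns 3%N; rewrite subSS subSS subn1.
have H4 : N ^+ 4 * ((p ^+ 2) ^+ 2 * (p ^+ 2 + (1 - p)) ^+ m.-2)
    <= expR 2 * (x ^+ 4 * expR (- (x / 2))).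
  have -> : expR 2 * (x ^+ 4 * expR (- (x / 2))) =
    N ^+ 4 * ((p ^+ 2) ^+ 2 * (expR 2 * expR (- (x / 2)))) by rewrite {1}xE; ring.
  have N0 : 0 <= N by lra.
  rewrite ler_wpM2l ?exprn_ge0 // ler_wpM2l ?exprn_ge0 //.
  (* As [1 - p >= 1 / 2], the exponent [N * p * (1 - p)] is at least [x / 2]. *)
  have -> : p ^+ 2 + (1 - p) = 1 - p * (1 - p) by ring.
  apply: le_trans (onem_exp_le _ _) _; first nra.
  rewrite -expRD ler_expR.
  have := Ns 4%N; rewrite !subSS subn2 => h.
  have pq : 0 <= p * (1 - p) by rewrite mulr_ge0 //; lra.
  have := ler_wpM2r pq h; rewrite xE.
  have : N * p * (1 / 2) <= N * p * (1 - p) by rewrite ler_wpM2l ?mulr_ge0 //; lra.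
  have : p * (1 - p) <= 1 / 2 by nra.
  rewrite !mulrA; nra.
have K1 : N * x * expR (- x) <= 6 / w.
  by rewrite -{1}expRt; apply: mul_expRN_le => //; rewrite xE.
have K2 : x ^+ 3 * expR (- x) <= 24 / t.
  rewrite expRN ler_pdivrMr ?expR_gt0 // mulrAC ler_pdivlMr; last lra.
  have := expR_ge_pow 3 (ltW x0); rewrite (_ : 4`! = 24)%N // => h.
  have : x ^+ 3 * t <= x ^+ 4 by rewrite [leRHS]exprSr ler_wpM2l ?exprn_ge0 // ltW.
  lra.
have K3 : x ^+ 4 * expR (- (x / 2)) <= 3840 / t.
  rewrite expRN ler_pdivrMr ?expR_gt0 // mulrAC ler_pdivlMr; last lra.
  have x20 : 0 <= x / 2 by lra.
  have := expR_ge_pow 4 x20; rewrite (_ : 5`! = 120)%N // => h.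
  have : x ^+ 4 * t <= x ^+ 5 by rewrite [leRHS]exprSr ler_wpM2l ?exprn_ge0 // ltW.
  have : (x / 2) ^+ 5 = x ^+ 5 / 32 by field.
  lra.
move=> we te; have W : 6 / w * 2 * expR 2 <= eps / 2.
  rewrite mulrAC -mulrA mulrAC ler_pdivrMr //.
  by move: we; rewrite ler_pdivrMr //; lra.
have T : (24 / t + 3840 / t) * expR 2 <= eps / 2.
  rewrite -mulrDl mulrAC ler_pdivrMr; last lra.
  by move: te; rewrite ler_pdivrMr //; lra.
rewrite /dom_bound -NE.
have K12 := ler_wpM2l (ltW E2) K1; have K23 := ler_wpM2l (ltW E2) (lerD K2 K3).
rewrite mulrDr in K23; lra.
Qed.

End Pointwise.

(** * Passage to the limit *)

Local Open Scope classical_set_scope.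
Local Open Scope ring_scope.

(** The bounds for fixed size concern [m.+2] vertices; this lemma and the next translate eventual
    statements between [n] and [m.+2]. *)
Lemma near_shift2 (P : nat -> Prop) :
  (\forall n \near \oo, P n) -> \forall m \near \oo, P m.+2.
Proof. by move=> [k _ h]; exists k => // m /= km; apply: h => /=; lia. Qed.

Lemma near_unshift2 (P : nat -> Prop) :
  (\forall m \near \oo, P m.+2) -> \forall n \near \oo, P n.
Proof.
by move=> [k _ h]; exists k.+2 => // -[|[|m]] //= km; apply: h.
Qed.

Section Asymptotics.
Context {R : realType}.
Implicit Types (p : nat -> R) (C : R).

Lemma near_ln_ge (K : R) : \forall n \near \oo, K <= ln (n%:R : R).
Proof.
near=> n; rewrite -[K]expRK ler_ln ?posrE ?expR_gt0 //; last first.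
  by apply: lt_le_trans (expR_gt0 K) _; near: n; apply: nbhs_infty_ger.
by near: n; apply: nbhs_infty_ger.
Unshelve. all: by end_near. Qed.

Lemma aas_from_compl p (P : forall n, pred (graph n)) : (forall n, 0 <= p n <= 1) ->
  (forall eps, 0 < eps -> \forall m \near \oo,
    gnp_prob (p m.+2) (fun g => ~~ P m.+2 g) <= eps) ->
  aas p P.
Proof.
move=> hp H; apply/cvgrPdist_le => eps e0; apply: near_unshift2.
apply: filterS (H _ e0) => m h; rewrite gnp_prob_not.
by rewrite opprB addrC subrK ger0_norm // gnp_prob_ge0.
Qed.

Lemma aas_setC p (P Q : forall n, pred (graph n)) :
  (forall n g, P n (~: g) = Q n g) -> aas (fun n => 1 - p n) P -> aas p Q.
Proof.
move=> PQ; rewrite /aas; apply: cvg_trans; apply: near_eq_cvg.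
by apply: nearW => n; rewrite gnp_probC; apply: eq_bigl => g.
Qed.

Lemma aas_no_adj_dom p : (forall n, 0 <= p n <= 1) ->
  (p n * n%:R ^+ 2) @[n --> \oo] --> (0 : R) ->
  aas p (fun n g => n_adj_dom g == 0%N).
Proof.
move=> hp /cvgrPdist_le H; apply: aas_from_compl => // eps /H/near_shift2.
apply: filterS => m; rewrite sub0r normrN => h.
apply: le_trans (prob_adj_dom (hp _)) _; rewrite mulrC.
by apply: le_trans h; rewrite ler_norm.
Qed.

(* The lower bound on [n^2 p] is a premise for each [n] separately, because in (2)
   it is available only for those [n] with [n p > (3/4) log n]. *)
Lemma near_few_leaves p C omega eps : (forall n, 0 <= p n <= 1) -> 0 < C -> 0 < eps ->
  omega n @[n --> \oo] --> +oo ->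
  (\forall n \near \oo, p n < (thr R n - omega n) / n%:R) ->
  exists K : R, \forall m \near \oo, K <= p m.+2 * m.+2%:R ^+ 2 ->
    gnp_prob (p m.+2) (fun g : graph m.+2 => (\sum_bc (leaf_at bc g : nat))%:R < C) <= eps.
Proof.
move=> hp C0 e0 /cvgryPge w pw.
have [M ME] : exists M, M = 2 * expR 1 * (2 * C + 16 / eps) by eexists.
(* This turns the last premise of [prob_few_leaves_le] into a lower bound on [n ^ 2 p]. *)
exists (M * expR 1).
have wM := near_shift2 (w (2 * M)); have {}pw := near_shift2 pw.
have t1 := near_shift2 (near_ln_ge (2 * M)).
have t2 := near_shift2 (near_ln_ge 48); have t3 := near_shift2 (near_ln_ge (64 / eps)).
near=> m => hK; have [p0 p1] := andP (hp m.+2).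
have N0 : 0 < m.+2%:R :> R by [].
apply: (@prob_few_leaves_le R m m.+2%:R (ln m.+2%:R) _ _ _ _ eps (omega m.+2) M) => //;
  rewrite ?lnK ?posrE //; try by near: m.
  have : p m.+2 < (thr R m.+2 - omega m.+2) / m.+2%:R by near: m.
  by rewrite ltr_pdivlMr // mulrC /thr => /ltW.
by apply: le_trans hK _; rewrite le_eqVlt; apply/orP; left; apply/eqP; ring.
Unshelve. all: by end_near. Qed.

Lemma aas_adj_dom_ge p C omega : (forall n, 0 <= p n <= 1) -> 0 < C ->
  omega n @[n --> \oo] --> +oo ->
  (\forall n \near \oo, p n < (thr R n - omega n) / n%:R) ->
  (p n * n%:R ^+ 2) @[n --> \oo] --> +oo ->
  aas p (fun n g => C <= (n_adj_dom g)%:R).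
Proof.
move=> hp C0 w pw /cvgryPge pn; apply: aas_from_compl => // eps e0.
have [K HK] := near_few_leaves hp C0 e0 w pw.
apply: filterS2 HK (near_shift2 (pn K)) => m few pK; apply: le_trans (few pK).
apply: gnp_prob_le => // g; rewrite -ltNge => h; apply: le_lt_trans h.
by rewrite ler_nat leaf_count_le_adj_dom.
Qed.

Lemma aas_nonadj_dom_ge p C omega : (forall n, 0 <= p n <= 1) -> 0 < C ->
  omega n @[n --> \oo] --> +oo ->
  (\forall n \near \oo, p n < (thr R n - omega n) / n%:R) ->
  aas p (fun n g => C <= (n_nonadj_dom g)%:R).
Proof.
move=> hp C0 w pw; apply: aas_from_compl => // eps e0.
have e20 : 0 < eps / 2 by rewrite divr_gt0.
have [K HK] := near_few_leaves hp C0 e20 w pw.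
have {w}w0 : \forall m \near \oo, 0 <= omega m.+2.
  by move/cvgryPge: w => w; exact: near_shift2 (w 0).
have {}pw := near_shift2 pw.
have T x := near_shift2 (near_ln_ge x).
have t1 := T 48; have t2 := T (64 / eps); have t3 := T (4 * (2 + 8 / eps)).
have t4 := T (16 * expR 2 / (eps / 2)); have t5 := T (Num.max K C).
near=> m; have [p0 p1] := andP (hp m.+2).
have [N NE] : exists N : R, N = m.+2%:R by eexists.
have [t tE] : exists t : R, t = ln N by eexists.
have N0 : 0 < N by rewrite NE.
have tN : expR t = N by rewrite tE lnK.
have t48 : 48 <= t by rewrite tE NE; near: m.
have t64 : 64 / eps <= t by rewrite tE NE; near: m.
have t8 : 4 * (2 + 8 / eps) <= t by rewrite tE NE; near: m.
have t16 : 16 * expR 2 / (eps / 2) <= t by rewrite tE NE; near: m.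
have tm : Num.max K C <= t by rewrite tE NE; near: m.
have [tK tC] : K <= t /\ C <= t by move: tm; rewrite ge_max => /andP.
have Nt : t + 1 <= N by rewrite -tN addrC expR_ge1Dx.
have om : 0 <= omega m.+2 by near: m.
have xt : N * p m.+2 <= t + ln t.
  have : p m.+2 < (thr R m.+2 - omega m.+2) / m.+2%:R by near: m.
  by rewrite ltr_pdivlMr // mulrC /thr -NE -tE => /ltW; lra.
(* The sequence may alternate between the two regimes, so the split is made for each [m]. An
   isolated vertex gives [m.+1 >= t >= C] pairs. *)
have [small|large] := leP (N * p m.+2) (3 / 4 * t).
  apply: le_trans (prob_no_isolated_le NE tN e0 p0 t48 t64 t8 small).
  apply: gnp_prob_le => // g; apply: contra => /existsP[b /isolated_nonadj_dom mn].
  apply: (@le_trans _ _ m.+1%:R); last by rewrite ler_nat.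
  by move: Nt; rewrite NE -natr1; lra.
apply: (@le_trans _ _ (gnp_prob (p m.+2) (fun g : graph m.+2 =>
   ((\sum_bc (leaf_at bc g : nat))%:R < C) || [exists bc, isolated_edge_at bc g]))).
  apply: gnp_prob_le => // g; rewrite -ltNge => few.
  have [//|] := boolP [exists bc, isolated_edge_at bc g]; first by rewrite orbT.
  rewrite negb_exists orbF => /forallP noI; apply: le_lt_trans few.
  by rewrite ler_nat leaf_count_le_nonadj_dom.
apply: le_trans (gnp_prob_or _ _ (hp _)) _; rewrite [leRHS]splitr; apply: lerD.
  (* In this regime [p N ^ 2] exceeds [(3/4) t N], hence [t] and [K]. *)
  have HKm : K <= p m.+2 * m.+2%:R ^+ 2 -> gnp_prob (p m.+2) (fun g : graph m.+2 =>
      (\sum_bc (leaf_at bc g : nat))%:R < C) <= eps / 2 by near: m.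
  apply: HKm; rewrite -NE; apply: le_trans tK _.
  have -> : p m.+2 * N ^+ 2 = N * p m.+2 * N by ring.
  nra.
have t0 : 0 < t by lra.
have lt : ln t <= t by apply/ltW/ln_sublinear.
have [pt _] := sparse_small NE tN t48 p0 xt.
apply: (prob_isolated_edge_le NE tN e20 _ t0 t16).
  rewrite p0 /=; apply: le_trans pt _; rewrite ler_pdivrMr //; lra.
by apply/andP; split; lra.
Unshelve. all: by end_near. Qed.

Lemma aas_no_dom p omega1 omega2 : (forall n, 0 <= p n <= 1) ->
  omega1 n @[n --> \oo] --> +oo -> omega2 n @[n --> \oo] --> +oo ->
  (\forall n \near \oo, (thr R n + omega1 n) / n%:R < p n /\
                        p n < 1 - (thr R n + omega2 n) / n%:R) ->
  aas p (fun n g => (n_adj_dom g == 0%N) && (n_nonadj_dom g == 0%N)).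
Proof.
have onem_half (x : R) : x <= 1 -> 1 / 2 < x -> 0 <= 1 - x <= 1 / 2 by lra.
move=> hp /cvgryPge w1 /cvgryPge w2 pw; apply: aas_from_compl => // eps e0.
have [W WE] : exists W, W = 24 * expR 2 / eps by eexists.
have W0 : 0 < W by rewrite WE divr_gt0 // mulr_gt0 ?expR_gt0.
have {}w1 := near_shift2 (w1 W); have {}w2 := near_shift2 (w2 W).
have {}pw := near_shift2 pw.
have t1 := near_shift2 (near_ln_ge 1).
have t2 := near_shift2 (near_ln_ge (7728 * expR 2 / eps)).
near=> m; have N0 : 0 < m.+2%:R :> R by [].
have tN : expR (ln m.+2%:R) = m.+2%:R :> R by rewrite lnK.
(* To be applied to whichever of [p] and [1 - p] is at most 1/2, with the constant [W] in place of
   [omega1] or [omega2]. *)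
have bound (q : R) : 0 <= q <= 1 / 2 -> (thr R m.+2 + W) / m.+2%:R <= q ->
    gnp_prob q (fun g : graph m.+2 =>
      ~~ ((n_adj_dom g == 0%N) && (n_nonadj_dom g == 0%N))) <= eps.
  move=> q2 qw; have /andP[q0 q1] := q2.
  apply: le_trans (prob_dom_le _) _; first by apply/andP; split=> //; lra.
  apply: (dom_bound_le (erefl _) tN e0 q2 _ W0); rewrite -?WE //; try by near: m.
  by move: qw; rewrite ler_pdivrMr // mulrC /thr.
have [h1 h2] : (thr R m.+2 + omega1 m.+2) / m.+2%:R < p m.+2 /\
               p m.+2 < 1 - (thr R m.+2 + omega2 m.+2) / m.+2%:R by near: m.
have o1 : W <= omega1 m.+2 by near: m.
have o2 : W <= omega2 m.+2 by near: m.
have [p0 p1] := andP (hp m.+2).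
have N1 : 0 <= (m.+2%:R : R)^-1 by rewrite invr_ge0.
have [p2|p2] := leP (p m.+2) (1 / 2).
  apply: bound; first by rewrite p0.
  by apply: le_trans (ltW h1); rewrite ler_wpM2r // lerD2l.
have := bound (1 - p m.+2); rewrite gnp_probC.
(* Having no domination pair of either kind is invariant under complementation. *)
have sym : (fun g : graph m.+2 => ~~ ((n_adj_dom (~: g) == 0%N) && (n_nonadj_dom (~: g) == 0%N)))
  = (fun g => ~~ ((n_adj_dom g == 0%N) && (n_nonadj_dom g == 0%N))).
  by apply/funext => g; rewrite n_adj_dom_setC n_nonadj_dom_setC andbC.
rewrite sym; apply; first exact: onem_half.
have : (thr R m.+2 + W) / m.+2%:R <= (thr R m.+2 + omega2 m.+2) / m.+2%:R.
  by rewrite ler_wpM2r // lerD2l.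
by move=> h; apply: le_trans h _; move: h2; rewrite ltrBrDr -ltrBrDl => /ltW.
Unshelve. all: by end_near. Qed.

End Asymptotics.

(** * The seven regimes *)

Theorem theorem1p4 (R : realType) (C : R) (hC : 0 < C)
  (p : nat -> R) (hp : forall n, 0 <= p n <= 1) :
  (* (1) *)
  ((p n * n%:R ^+ 2) @[n --> \oo] --> (0 : R) ->
     aas p (fun n g => n_adj_dom g == 0%N)) /\
  (* (2) *)
  ((exists omega : nat -> R, omega n @[n --> \oo] --> +oo /\
      \forall n \near \oo, p n < (thr R n - omega n) / n%:R) ->
     aas p (fun n g => C <= (n_nonadj_dom g)%:R)) /\
  (* (3) *)
  ((exists omega : nat -> R, omega n @[n --> \oo] --> +oo /\
      \forall n \near \oo, p n < (thr R n - omega n) / n%:R) ->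
   (p n * n%:R ^+ 2) @[n --> \oo] --> +oo ->
     aas p (fun n g => C <= (n_adj_dom g)%:R)) /\
  (* (4) *)
  ((exists omega1 omega2 : nat -> R,
      omega1 n @[n --> \oo] --> +oo /\ omega2 n @[n --> \oo] --> +oo /\
      \forall n \near \oo, (thr R n + omega1 n) / n%:R < p n /\
                           p n < 1 - (thr R n + omega2 n) / n%:R) ->
     aas p (fun n g => (n_adj_dom g == 0%N) && (n_nonadj_dom g == 0%N))) /\
  (* (5) *)
  ((exists omega : nat -> R, omega n @[n --> \oo] --> +oo /\
      \forall n \near \oo, 1 - (thr R n - omega n) / n%:R < p n) ->
     aas p (fun n g => C <= (n_adj_dom g)%:R)) /\
  (* (6) *)
  ((exists omega : nat -> R, omega n @[n --> \oo] --> +oo /\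
      \forall n \near \oo, 1 - (thr R n - omega n) / n%:R < p n) ->
   ((1 - p n) * n%:R ^+ 2) @[n --> \oo] --> +oo ->
     aas p (fun n g => C <= (n_nonadj_dom g)%:R)) /\
  (* (7) *)
  (((1 - p n) * n%:R ^+ 2) @[n --> \oo] --> (0 : R) ->
     aas p (fun n g => n_nonadj_dom g == 0%N)).
Proof.
have hq n : 0 <= 1 - p n <= 1 by have := hp n; lra.
have flip omega : (\forall n \near \oo, 1 - (thr R n - omega n) / n%:R < p n) ->
    \forall n \near \oo, 1 - p n < (thr R n - omega n) / n%:R.
  by apply: filterS => n; lra.
split; first exact: aas_no_adj_dom.
split; first by move=> [w [w1 w2]]; exact: aas_nonadj_dom_ge w1 w2.
split; first by move=> [w [w1 w2]]; exact: aas_adj_dom_ge w1 w2.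
split; first by move=> [w1 [w2 [h1 [h2 h3]]]]; exact: aas_no_dom h1 h2 h3.
split.
  move=> [w [w1 /flip w2]]; apply: aas_setC (aas_nonadj_dom_ge hq hC w1 w2) => n g.
  by rewrite n_nonadj_dom_setC.
split.
  move=> [w [w1 /flip w2]] pn; apply: aas_setC (aas_adj_dom_ge hq hC w1 w2 pn) => n g.
  by rewrite n_adj_dom_setC.
move=> pn; apply: aas_setC (aas_no_adj_dom hq pn) => n g.
by rewrite n_adj_dom_setC.
Qed.
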